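(* Let $d\geq 1$, let $A$ be a finite-dimensional algebra over a field and let $\mathcal{M}\subseteq\operatorname{mod}A$ be a $d$-cluster tilting subcategory. Then the diagram with the two composites $$\mathcal{T}\xmapsto{\ \phi_1\ }(T,P)\xmapsto{\ \alpha\ }\alpha(T,P)\qquad\text{and}\qquad \mathcal{T}\xmapsto{\ -\cap\mathcal{M}\ }\mathcal{T}\cap\mathcal{M}\xmapsto{\ \phi_d\ }(M_{\mathcal{T}\cap\mathcal{M}},P_{\mathcal{T}\cap\mathcal{M}})\xmapsto{\ \beta\ }M_{\mathcal{T}\cap\mathcal{M}}$$ from functorially finite torsion classes $\mathcal{T}$ in $\operatorname{mod}A$ inducing $d$-torsion classes in $\mathcal{M}$ to (isomorphism classes of) objects of $\mathcal{M}$ commutes; that is, for every such $\mathcal{T}$, one has $\alpha(\phi_1(\mathcal{T}))\cong\beta(\phi_d(\mathcal{T}\cap\mathcal{M}))$.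
   Context: $\operatorname{mod}A$ is the category of finitely generated right $A$-modules. All subcategories are full and closed under isomorphisms, finite direct sums and direct summands. A functorially finite subcategory $\mathcal{M}\subseteq\operatorname{mod}A$ is $d$-cluster tilting if $\mathcal{M}=\{X\mid \operatorname{Ext}^i_A(X,M)=0\ \forall M\in\mathcal{M},\,1\le i\le d-1\}=\{Y\mid \operatorname{Ext}^i_A(M,Y)=0\ \forall M\in\mathcal{M},\,1\le i\le d-1\}$. A subcategory $\mathcal{U}\subseteq\mathcal{M}$ is a $d$-torsion class if for every $M\in\mathcal{M}$ there is an exact sequence $0\to U_M\to M\to V_1\to\cdots\to V_d\to 0$ in $\operatorname{mod}A$ with all terms in $\mathcal{M}$, such that $U_M\in\mathcal{U}$ and $0\to\operatorname{Hom}_A(U,V_1)\to\cdots\to\operatorname{Hom}_A(U,V_d)\to 0$ is exact for every $U\in\mathcal{U}$; $U_M$ is the $d$-torsion subobject of $M$. A torsion class $\mathcal{T}$ in $\operatorname{mod}A$ induces a $d$-torsion class in $\mathcal{M}$ if $\mathcal{U}=\mathcal{T}\cap\mathcal{M}$ is a $d$-torsion class in $\mathcal{M}$ and the torsion subobject $tM$ equals $U_M$ for all $M\in\mathcal{M}$. In that case, if $\mathcal{T}$ is functorially finite, so is $\mathcal{T}\cap\mathcal{M}$. $X\in\mathcal{U}$ is $\operatorname{Ext}^d$-projective in $\mathcal{U}$ if $\operatorname{Ext}^d_A(X,U)=0$ for all $U\in\mathcal{U}$; it is an $\operatorname{Ext}^d$-projective generator of $\mathcal{U}$ if moreover every $\operatorname{Ext}^d$-projective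 object of $\mathcal{U}$ lies in $\operatorname{add}(X)$. The maps. $\phi_d$ sends a functorially finite $d$-torsion class $\mathcal{U}$ in $\mathcal{M}$ to $(M_{\mathcal{U}},P_{\mathcal{U}})$, with $M_{\mathcal{U}}$ the basic $\operatorname{Ext}^d$-projective generator of $\mathcal{U}$ and $P_{\mathcal{U}}$ the maximal basic projective module with $\operatorname{Hom}_A(P_{\mathcal{U}},\mathcal{U})=0$. $\phi_1$ is the classical (Adachi--Iyama--Reiten) bijection from functorially finite torsion classes in $\operatorname{mod}A$ to basic support $\tau$-tilting pairs: $\mathcal{T}\mapsto(T,P)$ with $T$ the basic $\operatorname{Ext}^1$-projective generator of $\mathcal{T}$ (so $\mathcal{T}=\operatorname{Fac}T$) and $P$ the maximal basic projective with $\operatorname{Hom}_A(P,\mathcal{T})=0$. $\alpha$ sends a support $\tau$-tilting pair $(T,P)$ to the direct sum of the pairwise non-isomorphic indecomposable summands of $\bigoplus_{i=0}^{d-1}U_i^T$, where $0\to T\to U_0^T\to\cdots\to U_{d-1}^T\to0$ is the minimal $\mathcal{M}$-coresolution of $T$ (an exact sequence with $U_i^T\in\mathcal{M}$ obtained by iteratively taking minimal left $\mathcal{M}$-approximations of $T$ and of successive cokernels). $\beta$ sends a pair $(M,P)$ to $M$. *)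

(* Defs.v *)
From HB Require Import structures.
From mathcomp Require Import all_boot ssralg matrix falgebra.

Set Implicit Arguments.
Unset Strict Implicit.
Unset Printing Implicit Defensive.

Import GRing.Theory.
Local Open Scope ring_scope.

(* Everything is stated for finitely generated left modules over a ring R.
   A right A-module is a left module over the converse ring A^c (with
   x . a := (a : A^c) *: x), so mod A is [fgmod A^c] and Hom_A(X, Y) is
   [{linear X -> Y}].                                                      *)

Record fgmod (R : nzRingType) := FGMod {
  fgmod_car :> lmodType R;
  fgmod_gen : exists n (g : 'I_n -> fgmod_car),
    forall x, exists c : 'I_n -> R, x = \sum_(i < n) c i *: g i }.

(* Full subcategories, given by their objects. *)
Definition subcat (R : nzRingType) := fgmod R -> Prop.

Definition cap (R : nzRingType) (C D : subcat R) : subcat R :=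
  fun X => C X /\ D X.

Definition iso (R : nzRingType) (X Y : fgmod R) : Prop :=
  exists f : {linear X -> Y}, bijective f.

Definition zero_mod (R : nzRingType) (X : fgmod R) : Prop :=
  forall x : X, x = 0.

Definition surj (R : nzRingType) (X Y : fgmod R) (f : {linear X -> Y}) : Prop :=
  forall y, exists x, f x = y.

Definition exact_at (R : nzRingType) (X Y Z : fgmod R)
    (f : {linear X -> Y}) (g : {linear Y -> Z}) : Prop :=
  forall y, g y = 0 <-> exists x, f x = y.

Definition short_exact (R : nzRingType) (X Y Z : fgmod R)
    (f : {linear X -> Y}) (g : {linear Y -> Z}) : Prop :=
  [/\ injective f, exact_at f g & surj g].

(** Direct sums *)

Lemma mod0_gen (R : nzRingType) : exists n (g : 'I_n -> 'rV[R]_0),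
  forall x, exists c : 'I_n -> R, x = \sum_(i < n) c i *: g i.
Proof.
exists 0%N, (fun _ => 0) => x; exists (fun _ => 0).
by rewrite big_ord0; apply/rowP; case.
Qed.

Definition mod0 (R : nzRingType) : fgmod R := FGMod (@mod0_gen R).

Lemma dsum_gen (R : nzRingType) (X Y : fgmod R) :
  exists n (g : 'I_n -> (X * Y)%type),
    forall x, exists c : 'I_n -> R, x = \sum_(i < n) c i *: g i.
Proof.
case: (fgmod_gen X) => m [g gP]; case: (fgmod_gen Y) => n [h hP].
exists (m + n)%N, (fun i => match split i with
  | inl j => (g j, 0) | inr j => (0, h j) end) => -[x y].
have [c ->] := gP x; have [e ->] := hP y.
exists (fun i => match split i with inl j => c j | inr j => e j end).
have Sl i : split (lshift n i) = inl i :> 'I_m + 'I_n by exact: (unsplitK (inl i)).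
have Sr i : split (rshift m i) = inr i :> 'I_m + 'I_n by exact: (unsplitK (inr i)).
transitivity (\sum_(i < m) c i *: ((g i, 0) : (X * Y)%type) +
              \sum_(i < n) e i *: ((0, h i) : (X * Y)%type)).
  apply: injective_projections; rewrite /= !raddf_sum /=.
  - by rewrite [X in _ + X]big1 ?addr0 // => i _; rewrite scaler0.
  - by rewrite [X in X + _]big1 ?add0r // => i _; rewrite scaler0.
rewrite big_split_ord; congr (_ + _); apply: eq_bigr => i _.
- by rewrite Sl.
- by rewrite Sr.
Qed.

Definition dsum (R : nzRingType) (X Y : fgmod R) : fgmod R :=
  FGMod (dsum_gen X Y).

Definition dsums (R : nzRingType) (s : seq (fgmod R)) : fgmod R :=
  foldr (@dsum R) (mod0 R) s.

Definition dsummand (R : nzRingType) (Y X : fgmod R) : Prop :=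
  exists Z, iso X (dsum Y Z).

Definition add (R : nzRingType) (X : fgmod R) : subcat R :=
  fun Y => exists n, dsummand Y (dsums (nseq n X)).

Definition indecomposable (R : nzRingType) (X : fgmod R) : Prop :=
  ~ zero_mod X /\ forall Y Z, iso X (dsum Y Z) -> zero_mod Y \/ zero_mod Z.

Definition pairwise_noniso_indec (R : nzRingType) (s : seq (fgmod R)) : Prop :=
  (forall i, (i < size s)%N -> indecomposable (nth (mod0 R) s i)) /\
  (forall i j, (i < size s)%N -> (j < size s)%N ->
     iso (nth (mod0 R) s i) (nth (mod0 R) s j) -> i = j).

Definition basic (R : nzRingType) (X : fgmod R) : Prop :=
  exists s, pairwise_noniso_indec s /\ iso X (dsums s).

(* B is the direct sum of the pairwise non-isomorphic indecomposable
   summands of X. *)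
Definition basic_part (R : nzRingType) (X B : fgmod R) : Prop :=
  exists s, [/\ pairwise_noniso_indec s,
    forall Y, indecomposable Y ->
      (dsummand Y X <-> exists2 i, (i < size s)%N & iso Y (nth (mod0 R) s i))
    & iso B (dsums s)].

(* The standing convention on subcategories. *)
Definition is_subcat (R : nzRingType) (C : subcat R) : Prop :=
  [/\ forall X Y, iso X Y -> C X -> C Y,
      C (mod0 R),
      forall X Y, C X -> C Y -> C (dsum X Y)
    & forall X Y, dsummand Y X -> C X -> C Y].

(** Projective modules and vanishing of Ext *)

Definition projective (R : nzRingType) (P : fgmod R) : Prop :=
  forall (X Y : fgmod R) (p : {linear X -> Y}) (f : {linear P -> Y}),
    surj p -> exists g : {linear P -> X}, forall x, p (g x) = f x.

Record proj_resolution (R : nzRingType) (X : fgmod R) := ProjResolution {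
  res_ob : nat -> fgmod R;
  res_map : forall i, {linear res_ob i.+1 -> res_ob i};
  res_aug : {linear res_ob 0%N -> X};
  res_proj : forall i, projective (res_ob i);
  res_surj : surj res_aug;
  res_exact0 : exact_at (res_map 0%N) res_aug;
  res_exactS : forall i, exact_at (res_map i.+1) (res_map i) }.

Definition coboundary (R : nzRingType) (X Y : fgmod R) (P : proj_resolution X)
    (i : nat) : {linear res_ob P i -> Y} -> Prop :=
  match i return {linear res_ob P i -> Y} -> Prop with
  | 0 => fun c => forall x, c x = 0
  | j.+1 => fun c =>
      exists b : {linear res_ob P j -> Y}, forall x, c x = b (res_map P j x)
  end.

(* Ext^i(X, Y) = H^i(Hom(P, Y)) = 0, P a projective resolution of X. *)
Definition Ext_zero (R : nzRingType) (i : nat) (X Y : fgmod R) : Prop :=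
  forall (P : proj_resolution X) (c : {linear res_ob P i -> Y}),
    (forall x, c (res_map P i x) = 0) -> coboundary c.

(** Approximations and d-cluster tilting subcategories *)

Definition left_approx (R : nzRingType) (C : subcat R) (X U : fgmod R)
    (f : {linear X -> U}) : Prop :=
  C U /\ forall (V : fgmod R) (g : {linear X -> V}), C V ->
    exists h : {linear U -> V}, forall x, h (f x) = g x.

Definition right_approx (R : nzRingType) (C : subcat R) (U X : fgmod R)
    (f : {linear U -> X}) : Prop :=
  C U /\ forall (V : fgmod R) (g : {linear V -> X}), C V ->
    exists h : {linear V -> U}, forall v, f (h v) = g v.

Definition left_minimal (R : nzRingType) (X U : fgmod R)
    (f : {linear X -> U}) : Prop :=
  forall h : {linear U -> U}, (forall x, h (f x) = f x) -> bijective h.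

Definition functorially_finite (R : nzRingType) (C : subcat R) : Prop :=
  forall X : fgmod R,
    (exists (U : fgmod R) (f : {linear X -> U}), left_approx C f) /\
    (exists (U : fgmod R) (f : {linear U -> X}), right_approx C f).

Definition d_cluster_tilting (R : nzRingType) (d : nat) (M : subcat R) : Prop :=
  [/\ is_subcat M,
      functorially_finite M,
      forall X, M X <->
        (forall N, M N -> forall i, (0 < i < d)%N -> Ext_zero i X N)
    & forall Y, M Y <->
        (forall N, M N -> forall i, (0 < i < d)%N -> Ext_zero i N Y)].

(** Finite sequences; terms of index beyond the length in use are junk *)

Record mod_seq (R : nzRingType) := ModSeq {
  seq_ob :> nat -> fgmod R;
  seq_map : forall i, {linear seq_ob i -> seq_ob i.+1} }.

Definition cons_ob (R : nzRingType) (X : fgmod R) (S : mod_seq R) (i : nat) :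
  fgmod R := if i is j.+1 then S j else X.

(* X -f-> S 0 -> S 1 -> ... *)
Definition cons_seq (R : nzRingType) (X : fgmod R) (S : mod_seq R)
    (f : {linear X -> S 0%N}) : mod_seq R :=
  @ModSeq R (cons_ob X S)
    (fun i => match i return {linear cons_ob X S i -> cons_ob X S i.+1} with
              | 0 => f
              | j.+1 => seq_map S j
              end).

Definition from_prev (R : nzRingType) (S : mod_seq R) (i : nat) : S i -> Prop :=
  match i return S i -> Prop with
  | 0 => fun x => x = 0
  | j.+1 => fun x => exists y, seq_map S j y = x
  end.

(* 0 -> S 0 -> S 1 -> ... -> S n -> 0 is exact. *)
Definition exact_seq (R : nzRingType) (n : nat) (S : mod_seq R) : Prop :=
  forall i (x : S i), (i <= n)%N ->
    (((i < n)%N -> seq_map S i x = 0) <-> from_prev x).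

Definition hom_from_prev (R : nzRingType) (X : fgmod R) (S : mod_seq R)
    (i : nat) : {linear X -> S i} -> Prop :=
  match i return {linear X -> S i} -> Prop with
  | 0 => fun g => forall x, g x = 0
  | j.+1 => fun g =>
      exists h : {linear X -> S j}, forall x, seq_map S j (h x) = g x
  end.

(* 0 -> Hom(X, S 0) -> Hom(X, S 1) -> ... -> Hom(X, S n) -> 0 is exact. *)
Definition hom_exact_seq (R : nzRingType) (n : nat) (X : fgmod R)
    (S : mod_seq R) : Prop :=
  forall i (g : {linear X -> S i}), (i <= n)%N ->
    (((i < n)%N -> forall x, seq_map S i (g x) = 0) <-> hom_from_prev g).

(** Torsion classes and d-torsion classes *)

Definition torsion_class (R : nzRingType) (T : subcat R) : Prop :=
  [/\ is_subcat T,
      forall (X Y : fgmod R) (f : {linear X -> Y}), surj f -> T X -> T Y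
    & forall (X Y Z : fgmod R) (f : {linear X -> Y}) (g : {linear Y -> Z}),
        short_exact f g -> T X -> T Z -> T Y].

(* j is the inclusion of the torsion subobject tN into N. *)
Definition torsion_subobject (R : nzRingType) (T : subcat R) (N tN : fgmod R)
    (j : {linear tN -> N}) : Prop :=
  T tN /\ exists (V : fgmod R) (p : {linear N -> V}), short_exact j p /\
    forall (X : fgmod R) (g : {linear X -> V}), T X -> forall x, g x = 0.

(* i is the inclusion of the d-torsion subobject UN into N; the terms
   V_1, ..., V_d of the exact sequence are V 0, ..., V d.-1. *)
Definition d_torsion_subobject (R : nzRingType) (d : nat) (M U : subcat R)
    (N UN : fgmod R) (i : {linear UN -> N}) : Prop :=
  [/\ U UN, M UN & exists (V : mod_seq R) (p : {linear N -> V 0%N}),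
    [/\ forall j, (j < d)%N -> M (V j),
        exact_seq d.+1 (@cons_seq R UN (@cons_seq R N V p) i)
      & forall X, U X -> hom_exact_seq d.-1 X V]].

Definition d_torsion_class (R : nzRingType) (d : nat) (M U : subcat R) : Prop :=
  [/\ is_subcat U,
      forall X, U X -> M X
    & forall N, M N ->
        exists (UN : fgmod R) (i : {linear UN -> N}),
          d_torsion_subobject d M U i].

Definition same_subobject (R : nzRingType) (X Y N : fgmod R)
    (i : {linear X -> N}) (j : {linear Y -> N}) : Prop :=
  forall n : N, (exists x, i x = n) <-> (exists y, j y = n).

Definition induces_d_torsion_class (R : nzRingType) (d : nat)
    (M T : subcat R) : Prop :=
  d_torsion_class d M (cap T M) /\
  forall (N UN tN : fgmod R) (i : {linear UN -> N}) (j : {linear tN -> N}),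
    M N -> d_torsion_subobject d M (cap T M) i -> torsion_subobject T j ->
    same_subobject i j.

(** The maps phi_d, alpha and beta. They are defined up to isomorphism, so
    phi_d and alpha are given by their graphs. *)

Definition Ext_projective (R : nzRingType) (d : nat) (U : subcat R) : subcat R :=
  fun X => U X /\ forall Y, U Y -> Ext_zero d X Y.

Definition Ext_projective_generator (R : nzRingType) (d : nat) (U : subcat R)
    (X : fgmod R) : Prop :=
  Ext_projective d U X /\ forall Y, Ext_projective d U Y -> add X Y.

Definition basic_proj_annihilating (R : nzRingType) (U : subcat R)
    (P : fgmod R) : Prop :=
  [/\ basic P, projective P
    & forall (X : fgmod R) (f : {linear P -> X}), U X -> forall x, f x = 0].

Definition phi (R : nzRingType) (d : nat) (U : subcat R)
    (XP : fgmod R * fgmod R) : Prop :=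
  [/\ basic XP.1,
      Ext_projective_generator d U XP.1,
      basic_proj_annihilating U XP.2
    & forall Q, basic_proj_annihilating U Q -> dsummand Q XP.2].

(* us = [:: U_0; ...; U_(n-1)] are the terms of a minimal M-coresolution
   0 -> X -> U_0 -> ... -> U_(n-1) -> 0, obtained by splicing the short exact
   sequences 0 -> C_i -> U_i -> C_(i+1) -> 0 with C_0 = X and C_n = 0. *)
Fixpoint min_coresolution (R : nzRingType) (M : subcat R) (X : fgmod R)
    (us : seq (fgmod R)) : Prop :=
  match us with
  | [::] => zero_mod X
  | U :: us' => exists (f : {linear X -> U}) (C : fgmod R) (q : {linear U -> C}),
      [/\ left_approx M f, left_minimal f, short_exact f q
        & min_coresolution M C us']
  end.

Definition alpha (R : nzRingType) (d : nat) (M : subcat R)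
    (TP : fgmod R * fgmod R) (B : fgmod R) : Prop :=
  exists us, [/\ size us = d, min_coresolution M TP.1 us
               & basic_part (dsums us) B].

Definition beta (R : nzRingType) (MP : fgmod R * fgmod R) : fgmod R := MP.1.

(* Main.v *)
Require Import Defs.
From HB Require Import structures.
From mathcomp Require Import all_boot ssralg zmodp matrix vector falgebra boolp.
From mathcomp Require Import zify.

(** Write U for the d-torsion class T cap M and
    0 -> T0 -> U_0 -> ... -> U_(d-1) -> 0 for the minimal M-coresolution of the
    Ext^1-projective generator T0 of T. Both modules to be compared are direct
    sums of pairwise non-isomorphic indecomposables, so by Krull-Schmidt
    ([basic_unique]) it is enough that they have the same indecomposable
    summands. This amounts to two facts: every U_i is Ext^d-projective in U
    ([coresolution_Ext_projective]), and every indecomposable Ext^d-projective of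
    U is a summand of some U_i ([Ext_projective_retract]).

    The first fact rests on the quotients N/tN with N in M. Since
    Hom(X, -) is exact on the sequence N/tN -> V_1 -> ... -> V_d for X in U,
    and the V_j have no higher extensions by M below degree d, Ext^j(X, N/tN) = 0
    for 0 <= j < d. Hence in a resolution of a torsion module by objects of M
    the torsion-free quotients form a split complex, and the torsion parts, which
    lie in U, still resolve the module ([torsion_resolution]). Now let C_i be the
    i-th cosyzygy of T0, so that C_i -> U_i is a minimal left M-approximation.
    By induction on i, Ext^1(C_i, K) = 0 for all K with a resolution of length
    < d by objects of U; for i = 0 this holds because such a K is torsion.
    Given an extension B of U_i by a module with a resolution of length d - 1,
    the map C_i -> U_i then lifts to B; as B is itself torsion and resolved by U,
    the lift extends from C_i to U_i, and minimality of the approximation splits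
    the extension. Embedding a module Y of U in the torsion part of an injective
    module, and repeating this with the cokernels, shifts Ext^d(U_i, Y) to such
    an Ext^1.

    The second fact is an argument in the category of functors on U. Since T0
    has a coresolution by left M-approximations, Hom(T0, -) has a projective
    resolution by functors Hom(U_i, -). So has Hom(P, -) for P projective, because
    the left T-approximation P -> T_P and its cokernel C_P are Ext^1-projective in
    T. If X in U is Ext^d-projective and P_d -> ... -> P_0 -> X is a projective
    presentation that is minimal at P_d, then
    0 -> Hom(X, -) -> Hom(P_0, -) -> ... -> Hom(P_d, -) -> 0 is exact on U, where
    exactness at P_d comes from Nakayama's lemma ([FP_Ext1]) and the vanishing of
    Ext^d(X, -) on all of T ([Ext_top_T]). The calculus of finite presentation
    type along this sequence yields an epimorphism from some Hom(E, -) onto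
    Hom(X, -), with E a sum of copies of the U_i; so X is a summand of E.

    All functors that occur are of the form Hom(Z, -), and are handled through
    the modules Z; extension groups enter only through their vanishing. *)

Set Implicit Arguments.
Unset Strict Implicit.
Unset Printing Implicit Defensive.

Import GRing.Theory.
Local Open Scope ring_scope.

(** * Linear maps, submodules and quotients *)

Section Linear.
Variable R : nzRingType.

Lemma linear_ex (V W : lmodType R) (f : V -> W) :
  (forall a x y, f (a *: x + y) = a *: f x + f y) ->
  exists g : {linear V -> W}, forall x, g x = f x.
Proof.
move=> H; pose L := GRing.isLinear.Build R V W *:%R f H.
by exists (HB.pack_for {linear V -> W} f L).
Qed.

Implicit Types X Y Z : fgmod R.

Definition lid X : {linear X -> X} := idfun.
Definition lzero X Y : {linear X -> Y} := \0.
Definition lcomp X Y Z (g : {linear Y -> Z}) (f : {linear X -> Y}) :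
  {linear X -> Z} := g \o f.
Definition ladd X Y (f g : {linear X -> Y}) : {linear X -> Y} := f \+ g.
Definition lsub X Y (f g : {linear X -> Y}) : {linear X -> Y} := f \- g.
Definition lfst X Y : {linear dsum X Y -> X} := fst.
Definition lsnd X Y : {linear dsum X Y -> Y} := snd.

Fact lpair_subproof X Y Z (f : {linear Z -> X}) (g : {linear Z -> Y}) :
  linear (fun z => (f z, g z) : dsum X Y).
Proof. by move=> a x y; rewrite !linearP. Qed.
Definition lpair X Y Z (f : {linear Z -> X}) (g : {linear Z -> Y}) :
  {linear Z -> dsum X Y} :=
  HB.pack_for {linear Z -> dsum X Y} (fun z => (f z, g z) : dsum X Y)
    (GRing.isLinear.Build R Z (dsum X Y) *:%R _ (lpair_subproof f g)).
Definition linl X Y : {linear X -> dsum X Y} := lpair (lid X) (lzero X Y).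
Definition linr X Y : {linear Y -> dsum X Y} := lpair (lzero Y X) (lid Y).

Lemma factor_surj (X Y Z : lmodType R) (f : {linear X -> Y}) (g : {linear X -> Z}) :
  (forall y, exists x, f x = y) -> (forall x, f x = 0 -> g x = 0) ->
  exists h : {linear Y -> Z}, forall x, h (f x) = g x.
Proof.
move=> /choice[s sK] ker.
have E x x' : f x = f x' -> g x = g x'.
  move=> e; apply/eqP; rewrite -subr_eq0 -linearB; apply/eqP/ker.
  by rewrite linearB e subrr.
have [|h hE] := @linear_ex Y Z (g \o s).
  move=> a x y /=; rewrite -linearP; apply: E.
  by rewrite linearP !sK.
by exists h => x; rewrite hE; apply: E; rewrite sK.
Qed.

Lemma factor_inj (X Y Z : lmodType R) (i : {linear Y -> X}) (g : {linear Z -> X}) :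
  injective i -> (forall z, exists y, i y = g z) ->
  exists h : {linear Z -> Y}, forall z, i (h z) = g z.
Proof.
move=> inj /choice[s sK]; have [|h hE] := @linear_ex Z Y s.
  by move=> a x y; apply: inj; rewrite linearP !sK linearP.
by exists h => z; rewrite hE.
Qed.

Lemma bij_linear_inv (X Y : lmodType R) (f : {linear X -> Y}) : bijective f ->
  exists g : {linear Y -> X}, cancel f g /\ cancel g f.
Proof.
case=> g fK gK; have [|h hE] := @linear_ex Y X g.
  by move=> a x y; apply: (can_inj fK); rewrite linearP !gK.
by exists h; split=> x; rewrite hE.
Qed.

Lemma inj_ker0 (X Y : lmodType R) (f : {linear X -> Y}) :
  (forall x, f x = 0 -> x = 0) -> injective f.
Proof.
move=> k x y e; apply/eqP; rewrite -subr_eq0; apply/eqP/k.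
by rewrite linearB e subrr.
Qed.

Lemma inj_surj_bij (X Y : lmodType R) (f : {linear X -> Y}) :
  injective f -> (forall y, exists x, f x = y) -> bijective f.
Proof.
by move=> inj /choice[g gK]; exists g => // x; apply: inj; rewrite gK.
Qed.

Definition closed_under (X : lmodType R) (S : X -> Prop) :=
  S 0 /\ forall a x y, S x -> S y -> S (a *: x + y).

End Linear.

Section SubType.
Variables (R : nzRingType) (X : lmodType R) (S : X -> Prop).
Hypothesis cS : closed_under S.

Record subm := Subm { subm_val : X; _ : `[< S subm_val >] }.
HB.instance Definition _ := [isSub for subm_val].
HB.instance Definition _ := [Choice of subm by <:].

Let S0 : S 0. Proof. by case: cS. Qed.
Let SP a x y : S x -> S y -> S (a *: x + y). Proof. by case: cS => _; exact. Qed.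
Let SA x y : S x -> S y -> S (x + y).
Proof. by rewrite -{2}[x]scale1r; exact: SP. Qed.
Let SZ a x : S x -> S (a *: x).
Proof. by move=> Sx; rewrite -[_ *: _]addr0; exact: SP. Qed.
Let SN x : S x -> S (- x).
Proof. by rewrite -scaleN1r; exact: SZ. Qed.

Let sP (u : subm) : S (val u). Proof. by apply/asboolP; case: u. Qed.
Let mk x (Sx : S x) : subm := Subm (introT (asboolP _) Sx).

Let zero := mk S0.
Let opp (u : subm) := mk (SN (sP u)).
Let add (u v : subm) := mk (SA (sP u) (sP v)).
Let scale a (u : subm) := mk (SZ a (sP u)).

Fact sub_addA : associative add.
Proof. by move=> x y z; apply: val_inj; exact: addrA. Qed.
Fact sub_addC : commutative add.
Proof. by move=> x y; apply: val_inj; exact: addrC. Qed.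
Fact sub_add0 : left_id zero add.
Proof. by move=> x; apply: val_inj; exact: add0r. Qed.
Fact sub_addN : left_inverse zero opp add.
Proof. by move=> x; apply: val_inj; exact: addNr. Qed.
HB.instance Definition _ := GRing.isZmodule.Build subm
  sub_addA sub_addC sub_add0 sub_addN.
Fact sub_scA a b (v : subm) : scale a (scale b v) = scale (a * b) v.
Proof. by apply: val_inj; exact: scalerA. Qed.
Fact sub_sc1 : left_id 1 scale. Proof. by move=> x; apply: val_inj; exact: scale1r. Qed.
Fact sub_scDr : right_distributive scale +%R.
Proof. by move=> a x y; apply: val_inj; exact: scalerDr. Qed.
Fact sub_scDl v : {morph scale^~ v : a b / a + b}.
Proof. by move=> a b; apply: val_inj; exact: scalerDl. Qed.
HB.instance Definition _ := GRing.Zmodule_isLmodule.Build R subm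
  sub_scA sub_sc1 sub_scDr sub_scDl.

Fact subm_val_linear : linear subm_val. Proof. by []. Qed.

Lemma subm_ex : exists (Y : lmodType R) (i : {linear Y -> X}), injective i /\
  forall x, S x <-> exists y, i y = x.
Proof.
have [i iE] := linear_ex subm_val_linear; exists subm, i; split.
  by move=> x y; rewrite !iE; exact: val_inj.
move=> x; split=> [Sx|[y <-]]; last by rewrite iE; exact: sP.
by exists (mk Sx); rewrite iE.
Qed.

(* The quotient by S is realised on canonical representatives of the cosets. *)
Let rep x := choose (fun y => `[< S (x - y) >]) x.
Let repP x : S (x - rep x).
Proof.
apply/asboolP; apply: (@chooseP _ (fun y => `[< S (x - y) >]) x).
by rewrite subrr; apply/asboolP.
Qed.
Let rep_eq x y : S (x - y) -> rep x = rep y.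
Proof.
move=> Sxy; have e : (fun z => `[< S (x - z) >]) =1 (fun z => `[< S (y - z) >]).
  move=> z; apply/asbool_equiv_eq; split=> H.
    by rewrite -[y](subrK x) -addrA; apply: SA => //; rewrite -opprB; exact: SN.
  by rewrite -[x](subrK y) -addrA; apply: SA.
rewrite /rep (eq_choose e); apply: choose_id.
- by apply/asboolP; rewrite -opprB; exact: SN.
- by rewrite subrr; apply/asboolP.
Qed.
Let rep_id x : rep (rep x) = rep x.
Proof. by apply: rep_eq; rewrite -opprB; apply: SN; exact: repP. Qed.

Record quom := Quom { quom_val : X; _ : rep quom_val == quom_val }.
HB.instance Definition _ := [isSub for quom_val].
HB.instance Definition _ := [Choice of quom by <:].

Definition proj x : quom := Quom (introT eqP (rep_id x)).
Let projE x y : S (x - y) -> proj x = proj y.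
Proof. by move=> H; apply: val_inj; exact: rep_eq. Qed.
Let proj_val (u : quom) : proj (val u) = u.
Proof. by apply: val_inj; apply/eqP; case: u. Qed.
Let val_proj x : S (x - val (proj x)). Proof. exact: repP. Qed.
Let val_proj' x : S (val (proj x) - x).
Proof. by rewrite -opprB; apply: SN. Qed.

Let qadd (u v : quom) : quom := proj (val u + val v).
Let qopp (u : quom) : quom := proj (- val u).
Let qscale a (u : quom) : quom := proj (a *: val u).
Let qaddE x y : qadd (proj x) (proj y) = proj (x + y).
Proof. by apply: projE; rewrite opprD addrACA; apply: SA. Qed.
Let qoppE x : qopp (proj x) = proj (- x).
Proof. by apply: projE; rewrite -opprD; apply: SN. Qed.
Let qscaleE a x : qscale a (proj x) = proj (a *: x).
Proof. by apply: projE; rewrite -scalerBr; apply: SZ. Qed.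

Fact quo_addA : associative qadd.
Proof.
move=> u v w; rewrite -(proj_val u) -(proj_val v) -(proj_val w).
by rewrite !qaddE addrA.
Qed.
Fact quo_addC : commutative qadd.
Proof. by move=> u v; rewrite /qadd addrC. Qed.
Fact quo_add0 : left_id (proj 0) qadd.
Proof. by move=> u; rewrite -(proj_val u) qaddE add0r. Qed.
Fact quo_addN : left_inverse (proj 0) qopp qadd.
Proof. by move=> u; rewrite -(proj_val u) qoppE qaddE addNr. Qed.
HB.instance Definition _ := GRing.isZmodule.Build quom
  quo_addA quo_addC quo_add0 quo_addN.
Fact quo_scA a b (v : quom) : qscale a (qscale b v) = qscale (a * b) v.
Proof. by rewrite -(proj_val v) !qscaleE scalerA. Qed.
Fact quo_sc1 : left_id 1 qscale.
Proof. by move=> v; rewrite -(proj_val v) qscaleE scale1r. Qed.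
Fact quo_scDr : right_distributive qscale +%R.
Proof.
move=> a u v; change (qscale a (qadd u v) = qadd (qscale a u) (qscale a v)).
by rewrite -(proj_val u) -(proj_val v) qaddE !qscaleE qaddE scalerDr.
Qed.
Fact quo_scDl v : {morph qscale^~ v : a b / a + b}.
Proof.
move=> a b; change (qscale (a + b) v = qadd (qscale a v) (qscale b v)).
by rewrite -(proj_val v) !qscaleE qaddE scalerDl.
Qed.
HB.instance Definition _ := GRing.Zmodule_isLmodule.Build R quom
  quo_scA quo_sc1 quo_scDr quo_scDl.

Fact proj_linear : linear proj.
Proof.
move=> a x y; change (proj (a *: x + y) = qadd (qscale a (proj x)) (proj y)).
by rewrite qscaleE qaddE.
Qed.

Lemma quom_ex : exists (Q : lmodType R) (q : {linear X -> Q}),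
  (forall y, exists x, q x = y) /\ forall x, q x = 0 <-> S x.
Proof.
have [q qE] := linear_ex proj_linear; exists quom, q; split.
  by move=> u; exists (val u); rewrite qE proj_val.
move=> x; rewrite qE; split=> [e|Sx]; last by apply: projE; rewrite subr0.
have := val_proj x; rewrite e => H.
rewrite -[x](subrK (val (proj 0))); apply: SA => //.
by rewrite -[val _]subr0; exact: val_proj'.
Qed.
End SubType.

(** * Abelian constructions on finitely generated modules *)
Definition injective_module (R : nzRingType) (I : fgmod R) : Prop :=
  forall (K E : fgmod R) (i : {linear K -> E}) (g : {linear K -> I}),
    injective i -> exists h : {linear E -> I}, forall x, h (i x) = g x.

(** What the argument needs of the category of finitely generated modules:
    it is abelian, its objects have finite length, and it has enough
    injectives. *)
Record artin_category (R : nzRingType) := ArtinCategory {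
  sub_fg : forall (X : fgmod R) (S : X -> Prop), closed_under S ->
    exists n (g : 'I_n -> X), (forall i, S (g i)) /\
      forall x, S x -> exists c : 'I_n -> R, x = \sum_(i < n) c i *: g i;
  len : fgmod R -> nat;
  len_inj : forall (X Y : fgmod R) (f : {linear X -> Y}),
    injective f -> (len X <= len Y)%N;
  len_inj_eq : forall (X Y : fgmod R) (f : {linear X -> Y}),
    injective f -> (len Y <= len X)%N -> surj f;
  len_surj : forall (X Y : fgmod R) (f : {linear X -> Y}),
    surj f -> (len Y <= len X)%N;
  len_surj_eq : forall (X Y : fgmod R) (f : {linear X -> Y}),
    surj f -> (len X <= len Y)%N -> injective f;
  enough_injectives : forall X : fgmod R,
    exists (I : fgmod R) (i : {linear X -> I}), injective i /\ injective_module I }.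

Section Modules.
Variables (R : nzRingType) (hR : artin_category R).
Implicit Types X Y Z W K E P Q B C I : fgmod R.

Lemma quotient_ex X (S : X -> Prop) : closed_under S ->
  exists (Q : fgmod R) (q : {linear X -> Q}), surj q /\ forall x, q x = 0 <-> S x.
Proof.
move=> /quom_ex[Q [q [qs qk]]].
have gen : exists n (g : 'I_n -> Q),
    forall x, exists c : 'I_n -> R, x = \sum_(i < n) c i *: g i.
  have [n [g gP]] := fgmod_gen X; exists n, (fun i => q (g i)) => y.
  have [x <-] := qs y; have [c ->] := gP x; exists c.
  by rewrite linear_sum; apply: eq_bigr => i _; rewrite linearZ.
by exists (FGMod gen), q.
Qed.

Lemma submodule_ex X (S : X -> Prop) : closed_under S ->
  exists (Y : fgmod R) (i : {linear Y -> X}), injective i /\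
    forall x, S x <-> exists y, i y = x.
Proof.
move=> cS; have [Y [i [ii iS]]] := subm_ex cS.
have gen : exists n (g : 'I_n -> Y),
    forall x, exists c : 'I_n -> R, x = \sum_(i < n) c i *: g i.
  have [n [g [gS gP]]] := sub_fg hR cS; exists n.
  have /choice[g' g'E] : forall j, exists y, i y = g j by move=> j; apply/iS.
  exists g' => y; have /iS/gP[c e] : exists z, i z = i y by exists y.
  exists c; apply: ii; rewrite e linear_sum; apply: eq_bigr => j _.
  by rewrite linearZ /= g'E.
by exists (FGMod gen), i.
Qed.

Lemma closed_ker X Y (f : {linear X -> Y}) : closed_under (fun x => f x = 0).
Proof. by split=> [|a x y fx fy]; rewrite ?linear0 // linearP fx fy scaler0 addr0. Qed.

Lemma closed_im X Y (f : {linear X -> Y}) : closed_under (fun y => exists x, f x = y).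
Proof.
split=> [|a x y [u <-] [v <-]]; first by exists 0; rewrite linear0.
by exists (a *: u + v); rewrite linearP.
Qed.

Lemma kernel_ex X Y (f : {linear X -> Y}) :
  exists K (i : {linear K -> X}), injective i /\ exact_at i f.
Proof. by have [K [i [ii iS]]] := submodule_ex (closed_ker f); exists K, i. Qed.

Lemma ses_kernel X Y (f : {linear X -> Y}) : surj f ->
  exists K (i : {linear K -> X}), short_exact i f.
Proof. by move=> fs; have [K [i [ii ie]]] := kernel_ex f; exists K, i. Qed.

Lemma coker_ex X Y (f : {linear X -> Y}) :
  exists C (q : {linear Y -> C}), surj q /\ exact_at f q.
Proof. by have [C [q [qs qk]]] := quotient_ex (closed_im f); exists C, q. Qed.

Lemma ses_coker X Y (f : {linear X -> Y}) : injective f ->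
  exists C (q : {linear Y -> C}), short_exact f q.
Proof. by move=> fi; have [C [q [qs qe]]] := coker_ex f; exists C, q. Qed.

Lemma image_ex X Y (f : {linear X -> Y}) :
  exists I (p : {linear X -> I}) (i : {linear I -> Y}),
    [/\ surj p, injective i & forall x, i (p x) = f x].
Proof.
have [I [i [ii iS]]] := submodule_ex (closed_im f).
have [|p pE] := @factor_inj _ _ _ _ i f ii.
  by move=> z; apply/iS; exists z.
exists I, p, i; split=> // y; have /iS[x fx] : exists y', i y' = i y by exists y.
by exists x; apply: ii; rewrite pE.
Qed.

Lemma pullback_ex X Y Z (f : {linear X -> Z}) (g : {linear Y -> Z}) :
  exists B (a : {linear B -> X}) (b : {linear B -> Y}),
    [/\ forall t, f (a t) = g (b t),
        forall x y, f x = g y -> exists t, a t = x /\ b t = y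
      & forall t, a t = 0 -> b t = 0 -> t = 0].
Proof.
pose h := lsub (lcomp f (lfst X Y)) (lcomp g (lsnd X Y)).
have [B [i [ii ie]]] := kernel_ex h.
exists B, (lcomp (lfst X Y) i), (lcomp (lsnd X Y) i); split.
- move=> t; apply/eqP; rewrite -subr_eq0; apply/eqP.
  by apply/(ie (i t)); exists t.
- move=> x y e; have [|t te] := (ie (x, y)).1.
    by rewrite /h /= e subrr.
  by exists t; rewrite /= te.
- move=> t /= e1 e2; apply: ii; rewrite linear0.
  by rewrite [LHS]surjective_pairing e1 e2.
Qed.

(** Stated for any B with the two properties of a pullback, so that it applies to
    the module provided by [pullback_ex]. *)
Lemma pullback_map X Y Z (f : {linear X -> Z}) (g : {linear Y -> Z}) B
    (a : {linear B -> X}) (b : {linear B -> Y})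
    W (u : {linear W -> X}) (v : {linear W -> Y}) :
  (forall x y, f x = g y -> exists t, a t = x /\ b t = y) ->
  (forall t, a t = 0 -> b t = 0 -> t = 0) ->
  (forall w, f (u w) = g (v w)) ->
  exists h : {linear W -> B}, forall w, a (h w) = u w /\ b (h w) = v w.
Proof.
move=> ex un e; have [| |h hE] := @factor_inj _ _ _ _ (lpair a b) (lpair u v).
- by apply: inj_ker0 => t [] /=; exact: un.
- by move=> w; have [t [ta tb]] := ex _ _ (e w); exists t; rewrite /= ta tb.
by exists h => w; have [] := hE w.
Qed.

Lemma pushout_ex X Y Z (f : {linear Z -> X}) (g : {linear Z -> Y}) :
  exists B (a : {linear X -> B}) (b : {linear Y -> B}),
    [/\ forall z, a (f z) = b (g z),
        forall x y, a x = b y -> exists z, f z = x /\ g z = y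
      & forall t, exists x y, t = a x - b y].
Proof.
have [B [q [qs qe]]] := coker_ex (lpair f g).
exists B, (lcomp q (linl X Y)), (lsub (lzero Y B) (lcomp q (linr X Y))).
have E x y : q (x, 0) - (0 - q (0, y)) = q ((x, y) : dsum X Y).
  rewrite sub0r opprK -linearD; congr (q _).
  by apply: injective_projections; rewrite /= ?addr0 ?add0r.
split.
- move=> z; apply/eqP; rewrite -subr_eq0 /= E; apply/eqP.
  by apply/(qe (f z, g z)); exists z.
- move=> x y /eqP; rewrite -subr_eq0 /= E => /eqP /(qe (x,y))[z [<- <-]].
  by exists z.
- move=> t; have [[x y] <-] := qs t; exists x, y; by rewrite /= E.
Qed.

Lemma ses_comp0 X Y Z (i : {linear X -> Y}) (p : {linear Y -> Z}) x :
  short_exact i p -> p (i x) = 0.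
Proof. by case=> _ e _; apply/e; exists x. Qed.

Lemma factor_ses X Y Z W (i : {linear X -> Y}) (p : {linear Y -> Z})
    (g : {linear Y -> W}) :
  exact_at i p -> surj p -> (forall x, g (i x) = 0) ->
  exists h : {linear Z -> W}, forall y, h (p y) = g y.
Proof. by move=> e s H; apply: factor_surj => // y /e[x <-]. Qed.

Lemma lift_ses X Y Z W (i : {linear X -> Y}) (p : {linear Y -> Z})
    (g : {linear W -> Y}) :
  exact_at i p -> injective i -> (forall w, p (g w) = 0) ->
  exists h : {linear W -> X}, forall w, i (h w) = g w.
Proof. by move=> e s H; apply: factor_inj => // w; apply/e. Qed.

Fact free_gen n : exists m (g : 'I_m -> {ffun 'I_n -> R^o}),
  forall x, exists c : 'I_m -> R, x = \sum_(i < m) c i *: g i.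
Proof.
exists n, (fun i => [ffun j => (i == j)%:R]) => x; exists x.
apply/ffunP=> j; rewrite sum_ffunE (bigD1 j) //= !ffunE eqxx.
rewrite [X in _ + X]big1 ?addr0 => [|i ne]; first by rewrite [RHS]mulr1.
by rewrite !ffunE (negPf ne) scaler0.
Qed.
Definition free_mod n : fgmod R := FGMod (@free_gen n).

Fact comb_linear n X (g : 'I_n -> X) :
  linear (fun c : free_mod n => \sum_(i < n) (c i : R) *: g i).
Proof.
move=> a x y; rewrite scaler_sumr -big_split; apply: eq_bigr => i _ /=.
by rewrite !ffunE scalerDl scalerA.
Qed.

Lemma free_projective n : projective (free_mod n).
Proof.
move=> X Y p f ps; have /choice[h hE] : forall i : 'I_n, exists x,
    p x = f ([ffun j => (i == j)%:R] : {ffun 'I_n -> R^o}).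
  by move=> i; exact: ps.
have [g gE] := linear_ex (comb_linear h); exists g => x.
rewrite gE linear_sum; transitivity (f (\sum_(i < n) (x i : R) *:
    ([ffun j => (i == j)%:R] : {ffun 'I_n -> R^o}))).
  rewrite linear_sum; apply: eq_bigr => i _; by rewrite !linearZ /= hE.
congr (f _); apply/ffunP=> j; rewrite sum_ffunE (bigD1 j) //= !ffunE eqxx.
rewrite [X in _ + X]big1 ?addr0 => [|i ne]; first by rewrite [LHS]mulr1.
by rewrite !ffunE (negPf ne) scaler0.
Qed.

Lemma free_cover X : exists n (p : {linear free_mod n -> X}), surj p.
Proof.
have [n [g gP]] := fgmod_gen X; have [p pE] := linear_ex (comb_linear g).
exists n, p => x; have [c ->] := gP x; exists [ffun i => c i].
by rewrite pE; apply: eq_bigr => i _; rewrite ffunE.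
Qed.

Lemma presentation X : exists K P (i : {linear K -> P}) (p : {linear P -> X}),
  projective P /\ short_exact i p.
Proof.
have [n [p ps]] := free_cover X; have [K [i ie]] := ses_kernel ps.
by exists K, (free_mod n), i, p; split=> //; exact: free_projective.
Qed.

Lemma dsum_projective P Q : projective P -> projective Q -> projective (dsum P Q).
Proof.
move=> hP hQ X Y p f ps.
have [g gE] := hP _ _ p (lcomp f (linl P Q)) ps.
have [h hE] := hQ _ _ p (lcomp f (linr P Q)) ps.
exists (ladd (lcomp g (lfst _ _)) (lcomp h (lsnd _ _))) => -[x y] /=.
rewrite linearD gE hE /= -linearD; congr (f _).
by apply: injective_projections; rewrite /= ?addr0 ?add0r.
Qed.

Lemma mod0_projective : projective (mod0 R).
Proof.
move=> X Y p f ps; exists (lzero _ _) => x.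
by rewrite /= linear0 (_ : x = 0) ?linear0 //; apply/rowP; case.
Qed.

End Modules.

(** * Vanishing of Ext *)
Section Ext.
Variables (R : nzRingType) (hR : artin_category R).
Implicit Types X Y Z W K L E P Q B C I F U V N : fgmod R.

(** Ext^1(X, Y) = 0, in the form in which it is used: maps to Y extend along
    kernels of epimorphisms onto X. *)
Definition Ext1 X Y : Prop :=
  forall K E (i : {linear K -> E}) (p : {linear E -> X}), short_exact i p ->
  forall g : {linear K -> Y}, exists h : {linear E -> Y}, forall x, h (i x) = g x.

(** [ExtS n X Y] is Ext^(n+1)(X, Y) = 0, by dimension shifting in X; see
    [Ext_zeroE]. The index is shifted by one because only positive degrees occur. *)
Fixpoint ExtS n X Y : Prop :=
  if n is m.+1 then
    forall K P (i : {linear K -> P}) (p : {linear P -> X}),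
      projective P -> short_exact i p -> ExtS m K Y
  else Ext1 X Y.

(** One projective presentation suffices to test Ext^1: any other epimorphism
    E -> X receives a map from P, and E is then a quotient of K' + P. *)
Lemma Ext1_proj K P X Y (i : {linear K -> P}) (p : {linear P -> X}) :
  projective P -> short_exact i p ->
  (forall g : {linear K -> Y}, exists h : {linear P -> Y}, forall x, h (i x) = g x) ->
  Ext1 X Y.
Proof.
move=> hP [ii ie ps] ext K' E i' p' [ii' ie' ps'] g.
have [l lE] := hP _ _ p' p ps'.
have [m /= mE] : exists m : {linear K -> K'}, forall x, i' (m x) = lcomp l i x.
  by apply: (lift_ses ie' ii') => w /=; rewrite lE; apply/ie; exists w.
have [h hE] := ext (lcomp g m).
pose s : {linear dsum K' P -> E} := ladd (lcomp i' (lfst _ _)) (lcomp l (lsnd _ _)).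
pose t : {linear dsum K' P -> Y} := ladd (lcomp g (lfst _ _)) (lcomp h (lsnd _ _)).
have [||r rE] := @factor_surj _ _ _ _ s t.
- move=> y; have [x px] := ps (p' y).
  have [|k ke] := (ie' (y - l x)).1; first by rewrite linearB lE px subrr.
  by exists (k, x); rewrite /s /= ke subrK.
- case=> k x; rewrite /s /t /= => /eqP; rewrite addr_eq0 => /eqP e.
  have [|z zx] := (ie x).1.
    apply: oppr_inj; rewrite oppr0 -lE -linearN -e; apply/ie'; by exists k.
  have -> : k = - m z by apply: ii'; rewrite linearN mE /= zx.
  by rewrite linearN -zx hE /= addNr.
exists r => x; have := rE ((x, 0) : dsum K' P); rewrite /s /t /=.
by rewrite !linear0 !addr0.
Qed.

(** Pull the sequence back along g and split it. *)
Lemma Ext1_lift X Y E Z (i : {linear Y -> E}) (p : {linear E -> Z}) :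
  Ext1 X Y -> short_exact i p -> forall g : {linear X -> Z},
  exists h : {linear X -> E}, forall x, p (h x) = g x.
Proof.
move=> hXY [ii ie ps] g.
have [B [a [b [ab ex un]]]] := pullback_ex hR p g.
have [j jE] : exists j : {linear Y -> B}, forall y, a (j y) = i y /\ b (j y) = 0.
  have [|j jE] := @pullback_map R E X Z p g B a b Y i (lzero _ _) ex un.
    by move=> w; rewrite linear0; apply/ie; exists w.
  by exists j.
have jb : short_exact j b.
  split.
  - by move=> y y' e; apply: ii; rewrite -(jE y).1 e (jE y').1.
  - move=> t; split=> [bt|[y <-]]; last by case: (jE y).
    have [|y ye] := (ie (a t)).1; first by rewrite ab bt linear0.
    exists y; apply/eqP; rewrite -subr_eq0; apply/eqP/un.
      by rewrite linearB (jE y).1 ye subrr.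
    by rewrite linearB (jE y).2 bt subr0.
  - by move=> x; have [e pe] := ps (g x); have [t [_ <-]] := ex _ _ pe; exists t.
have [r rE] := hXY _ _ _ _ jb (lid Y).
case: jb => _ jb bs.
have [|h hE] := factor_ses (g := lsub a (lcomp i r)) jb bs.
  by move=> y; rewrite /= rE (jE y).1 /= subrr.
exists h => x; have [t <-] := bs x; rewrite hE /= linearB ab.
by rewrite (_ : p (i _) = 0) ?subr0 //; apply/ie; exists (r t).
Qed.

(** Push the given sequence out along g; a section of the result is as good as a
    retraction, which provides the extension. *)
Lemma lift_Ext1 X Y :
  (forall E (i : {linear Y -> E}) (p : {linear E -> X}), short_exact i p ->
     exists h : {linear X -> E}, forall x, p (h x) = x) -> Ext1 X Y.
Proof.
move=> H K E i p [ii ie ps] g.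
have [B [a [b [ab ex un]]]] := pushout_ex i g.
have [q [q1 q2]] : exists q : {linear B -> X},
    (forall e, q (a e) = p e) /\ forall y, q (b y) = 0.
  pose s : {linear dsum E Y -> B} := lsub (lcomp a (lfst _ _)) (lcomp b (lsnd _ _)).
  have [||q qE] := @factor_surj _ _ _ _ s (lcomp p (lfst E Y)).
  - by move=> t; have [x [y ->]] := un t; exists (x, y).
  - case=> e y /= /eqP; rewrite subr_eq0 => /eqP /ex[z [<- _]].
    by apply/ie; exists z.
  exists q; split=> [e|y].
    by have := qE ((e, 0) : dsum E Y); rewrite /s /= linear0 ?subr0 ?addr0.
  have := qE ((0, y) : dsum E Y); rewrite /s /= !linear0 sub0r linearN => /eqP.
  by rewrite oppr_eq0 => /eqP.
have bq : short_exact b q.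
  split.
  - move=> y y' e; apply/eqP; rewrite -subr_eq0; apply/eqP.
    have [|z [iz <-]] := ex 0 (y - y'); first by rewrite linear0 linearB e subrr.
    by rewrite (_ : z = 0) ?linear0 //; apply: ii; rewrite iz linear0.
  - move=> t; split=> [qt|[y <-]]; last exact: q2.
    have [e [y te]] := un t.
    have [|k ke] := (ie e).1; first by rewrite -qt te linearB q1 q2 subr0.
    by exists (g k - y); rewrite linearB -ab ke.
  - by move=> x; have [e <-] := ps x; exists (a e).
have [h hE] := H _ _ _ bq; case: bq => bi be _.
have [|r rE] := lift_ses (g := lsub (lid B) (lcomp h q)) be bi.
  by move=> t; rewrite /= linearB hE subrr.
have rb y : r (b y) = y by apply: bi; rewrite rE /= q2 linear0 ?subr0 ?addr0.
exists (lcomp r a) => k /=; by rewrite ab rb.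
Qed.

Lemma projective_Ext1 P Y : projective P -> Ext1 P Y.
Proof.
move=> hP; apply: lift_Ext1 => E i p [_ _ ps].
by have [h hE] := hP _ _ p (lid P) ps; exists h.
Qed.

(** The syzygies of a stable retract: if the identity of Z' factors through Z up
    to a map through a projective module, then the same holds for the syzygies
    K' and K of Z' and Z, the projective module now being P'. *)
Lemma stable_retract_syzygy Z' Z Q K' P' K P
    (a : {linear Z' -> Z}) (b : {linear Z -> Z'})
    (u : {linear Z' -> Q}) (v : {linear Q -> Z'})
    (i' : {linear K' -> P'}) (p' : {linear P' -> Z'})
    (i : {linear K -> P}) (p : {linear P -> Z}) :
  projective Q -> projective P' -> projective P ->
  short_exact i' p' -> short_exact i p -> (forall x, b (a x) + v (u x) = x) ->
  exists (aP : {linear P' -> P}) (aK : {linear K' -> K})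
    (bK : {linear K -> K'}) (w : {linear P' -> K'}),
    (forall x, i (aK x) = aP (i' x)) /\ forall x, bK (aK x) + w (i' x) = x.
Proof.
move=> hQ hP' hP s' s e.
have [ii ie ps] := s; have [ii' ie' ps'] := s'.
have [bl blE] := hP _ _ p' (lcomp b p) ps'.
have [al alE] := hP' _ _ p (lcomp a p') ps.
have [vl vlE] := hQ _ _ p' v ps'.
have [bK /= bKE] : exists bK : {linear K -> K'}, forall x, i' (bK x) = lcomp bl i x.
  by apply: (lift_ses ie' ii') => x /=; rewrite blE /= (ses_comp0 _ s) linear0.
have [aK /= aKE] : exists aK : {linear K' -> K}, forall x, i (aK x) = lcomp al i' x.
  by apply: (lift_ses ie ii) => x /=; rewrite alE /= (ses_comp0 _ s') linear0.
(* bl al + vl u p' and the identity of P' both lift the identity of Z', so they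
   differ by a map into K'. *)
pose w0 : {linear P' -> P'} :=
  lsub (lsub (lid P') (lcomp bl al)) (lcomp vl (lcomp u p')).
have [w /= wE] : exists w : {linear P' -> K'}, forall x, i' (w x) = w0 x.
  apply: (lift_ses ie' ii') => x; rewrite /w0 /= !linearB /= blE /= alE /= vlE.
  by rewrite -addrA -opprD e subrr.
exists al, aK, bK, w; split=> // x; apply: ii'.
rewrite linearD bKE wE /w0 /= aKE /= (ses_comp0 _ s') !linear0 ?subr0 ?addr0.
by rewrite addrC subrK.
Qed.

(** Vanishing of Ext passes to stable retracts; this is what makes the choice
    of syzygies in the definition of ExtS irrelevant. *)
Lemma stable_retract n Z' Z Q Y (a : {linear Z' -> Z}) (b : {linear Z -> Z'})
    (u : {linear Z' -> Q}) (v : {linear Q -> Z'}) :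
  projective Q -> (forall x, b (a x) + v (u x) = x) -> ExtS n Z Y -> ExtS n Z' Y.
Proof.
elim: n Z' Z Q a b u v => [|n IH] Z' Z Q a b u v hQ e hZ;
  have [K [P [i [p [hP s]]]]] := presentation hR Z.
  have [K' [P' [i' [p' [hP' s']]]]] := presentation hR Z'.
  apply: (Ext1_proj hP' s') => g.
  have [al [aK [bK [w [aKE eK]]]]] := stable_retract_syzygy hQ hP' hP s' s e.
  have [h hE] := hZ _ _ _ _ s (lcomp g bK).
  exists (ladd (lcomp g w) (lcomp h al)) => x /=.
  by rewrite -aKE hE /= -linearD addrC eK.
move=> K' P' i' p' hP' s'.
have [_ [aK [bK [w [_ eK]]]]] := stable_retract_syzygy hQ hP' hP s' s e.
exact: (IH _ _ _ aK bK i' w hP' eK (hZ _ _ _ _ hP s)).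
Qed.

Lemma ExtS_retract n Z' Z Y (a : {linear Z' -> Z}) (b : {linear Z -> Z'}) :
  (forall x, b (a x) = x) -> ExtS n Z Y -> ExtS n Z' Y.
Proof.
move=> e; apply: (stable_retract (u := lzero Z' (mod0 R)) (v := lzero _ _)).
  exact: mod0_projective.
by move=> x /=; rewrite addr0.
Qed.

(** Two syzygies of the same module are stable retracts of each other. *)
Lemma ExtS_syzygy n K P X Y (i : {linear K -> P}) (p : {linear P -> X}) :
  projective P -> short_exact i p -> ExtS n K Y -> ExtS n.+1 X Y.
Proof.
move=> hP s hK K' P' i' p' hP' s'.
have [ii ie ps] := s; have [ii' ie' ps'] := s'.
have [f fE] := hP' _ _ p p' ps; have [g gE] := hP _ _ p' p ps'.
have [fK /= fKE] : exists fK : {linear K' -> K}, forall x, i (fK x) = lcomp f i' x.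
  by apply: (lift_ses ie ii) => x /=; rewrite fE (ses_comp0 _ s').
have [gK /= gKE] : exists gK : {linear K -> K'}, forall x, i' (gK x) = lcomp g i x.
  by apply: (lift_ses ie' ii') => x /=; rewrite gE (ses_comp0 _ s).
have [w /= wE] : exists w : {linear P' -> K'}, 
    forall x, i' (w x) = lsub (lid P') (lcomp g f) x.
  by apply: (lift_ses ie' ii') => x /=; rewrite linearB gE fE subrr.
apply: (stable_retract (a := fK) (b := gK) (u := i') (v := w) hP') hK => x.
by apply: ii'; rewrite linearD gKE wE /= fKE /= addrC subrK.
Qed.

Lemma projective_ExtS n P Y : projective P -> ExtS n P Y.
Proof.
elim: n P => [|n IH] P hP; first exact: projective_Ext1.
have s : short_exact (lzero (mod0 R) P) (lid P).
  split=> [x y _|x|x]; last by exists x.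
    by apply/rowP; case.
  by split=> [/= ->|[y <-]] //=; exists (0 : mod0 R).
by apply: (ExtS_syzygy hP s); apply: IH; exact: mod0_projective.
Qed.

(** * Long exact sequences for Ext *)

Section Covariant.
Variables (Y' Y Y'' : fgmod R) (i : {linear Y' -> Y}) (p : {linear Y -> Y''}).
Hypothesis s : short_exact i p.

(** Of the long exact sequence only the consequences for vanishing are needed. This
    one is exactness at Ext^j(X, Y'') for j > 0; the next two lemmas express
    exactness at Ext^1(X, Y') and at Ext^(j+1)(X, Y') for j > 0. *)
Lemma Ext_cov_quot n X : ExtS n X Y -> ExtS n.+1 X Y' -> ExtS n X Y''.
Proof.
elim: n X => [|n IH] X h h'.
  have [K [P [j [q [hP sq]]]]] := presentation hR X.
  apply: (Ext1_proj hP sq) => g.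
  have [g' g'E] := Ext1_lift (h' _ _ _ _ hP sq) s g.
  have [m mE] := h _ _ _ _ sq g'.
  by exists (lcomp p m) => x /=; rewrite mE g'E.
by move=> K P j q hP sq; apply: IH; [exact: h sq | exact: h' sq].
Qed.

Lemma Ext_cov_sub0 X :
  (forall g : {linear X -> Y''}, exists h : {linear X -> Y}, forall x, p (h x) = g x) ->
  Ext1 X Y -> Ext1 X Y'.
Proof.
have [ii ie ps] := s; move=> lft h K E j q sq g.
have [f fE] := h _ _ _ _ sq (lcomp i g).
have [ji je qs] := sq.
have [|r rE] := factor_ses (g := lcomp p f) je qs.
  by move=> x; rewrite /= fE /= (ses_comp0 _ s).
have [m mE] := lft r.
have [|t tE] := lift_ses (g := lsub f (lcomp m q)) ie ii.
  by move=> x; rewrite /= linearB mE rE subrr.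
exists t => x; apply: ii; rewrite tE /= fE /= (ses_comp0 _ sq) linear0 ?subr0 ?addr0 //.
Qed.

Lemma Ext_cov_sub n X : ExtS n X Y'' -> ExtS n.+1 X Y -> ExtS n.+1 X Y'.
Proof.
elim: n X => [|n IH] X h h' K P j q hP sq; last first.
  by apply: IH; [exact: h sq | exact: h' sq].
apply: Ext_cov_sub0 (h' _ _ _ _ hP sq) => g.
have [r rE] := h _ _ _ _ sq g.
have [ii ie ps] := s; have [m mE] := hP _ _ p r ps.
by exists (lcomp m j) => x; rewrite /= mE rE.
Qed.

End Covariant.

Lemma ExtS_retract2 n X Y' Y (a : {linear Y' -> Y}) (b : {linear Y -> Y'}) :
  (forall x, b (a x) = x) -> ExtS n X Y -> ExtS n X Y'.
Proof.
move=> e; elim: n X => [|n IH] X h.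
  move=> K E i p s g; have [h' h'E] := h _ _ _ _ s (lcomp a g).
  by exists (lcomp b h') => x; rewrite /= h'E /= e.
by move=> K P i p hP s; apply: IH; exact: h s.
Qed.

Section Contravariant.
Variables (F : fgmod R).

(** The long exact sequence in the first variable at the place
    Hom(E, F) -> Hom(K, F) -> Ext^1(X, F) -> Ext^1(E, F). *)
Lemma Ext_contra_quot0 K E X (i : {linear K -> E}) (p : {linear E -> X}) :
  short_exact i p ->
  (forall g : {linear K -> F}, exists h : {linear E -> F}, forall x, h (i x) = g x) ->
  Ext1 E F -> Ext1 X F.
Proof.
move=> s ext h; have [O [P [j [q [hP sq]]]]] := presentation hR E.
have [ii ie ps] := s; have [ji je qs] := sq.
have pqs : surj (lcomp p q).
  by move=> x; have [e <-] := ps x; have [t <-] := qs e; exists t.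
have [L [l sl]] := ses_kernel hR pqs; have [li le _] := sl.
apply: (Ext1_proj hP sl) => g.
have [m /= mE] : exists m : {linear O -> L}, forall x, l (m x) = j x.
  by apply: (lift_ses le li) => x /=; rewrite (ses_comp0 _ sq) linear0.
have [n /= nE] : exists n : {linear L -> K}, forall x, i (n x) = lcomp q l x.
  by apply: (lift_ses ie ii) => x /=; apply/(le (l x)); exists x.
have [h1 h1E] := h _ _ _ _ sq (lcomp g m).
have ns : surj n.
  move=> k; have [t tE] := qs (i k).
  have [|y ly] := (le t).1; first by rewrite /= tE (ses_comp0 _ s).
  by exists y; apply: ii; rewrite nE /= ly.
have [|r rE] := @factor_surj _ _ _ _ n (lsub g (lcomp h1 l)) ns.
  move=> y ny; have [|o oE] := (je (l y)).1.
    by rewrite -nE ny linear0.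
  have -> : y = m o by apply: li; rewrite mE.
  by rewrite /= mE h1E /= subrr.
have [f fE] := ext r.
exists (ladd h1 (lcomp f q)) => y /=.
by rewrite -nE fE rE /= addrC subrK.
Qed.

(** Projective presentations of the ends K and X of a short exact sequence combine
    to one of E, with syzygies forming a short exact sequence again; all higher
    cases of the long exact sequence reduce to degree 0 or 1 in this way. *)
Lemma horseshoe K E X (i : {linear K -> E}) (p : {linear E -> X})
    K1 P1 (i1 : {linear K1 -> P1}) (p1 : {linear P1 -> K})
    K2 P2 (i2 : {linear K2 -> P2}) (p2 : {linear P2 -> X}) :
  short_exact i p -> short_exact i1 p1 -> projective P2 -> short_exact i2 p2 ->
  exists L (l : {linear L -> dsum P1 P2}) (q : {linear dsum P1 P2 -> E})
    (a : {linear K1 -> L}) (b : {linear L -> K2}),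
    [/\ short_exact l q, short_exact a b, forall x, l (a x) = linl P1 P2 (i1 x)
      & forall y, lsnd P1 P2 (l y) = i2 (b y)].
Proof.
move=> s s1 hP2 s2; have [ii ie ps] := s.
have [i1i i1e p1s] := s1; have [i2i i2e p2s] := s2.
have [f fE] := hP2 _ _ p p2 ps.
pose q : {linear dsum P1 P2 -> E} :=
  ladd (lcomp i (lcomp p1 (lfst _ _))) (lcomp f (lsnd _ _)).
have qs : surj q.
  move=> e; have [y yE] := p2s (p e).
  have [|k kE] := (ie (e - f y)).1; first by rewrite linearB fE yE subrr.
  by have [x xE] := p1s k; exists (x, y); rewrite /q /= xE kE subrK.
have pq z : p (q z) = p2 (lsnd _ _ z).
  by rewrite /q /= linearD (ses_comp0 _ s) add0r fE.
have [L [l sl]] := ses_kernel hR qs; have [li le _] := sl.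
have [a /= aE] : exists a : {linear K1 -> L},
    forall x, l (a x) = lcomp (linl P1 P2) i1 x.
  by apply: (lift_ses le li) => x; rewrite /q /= (ses_comp0 _ s1) !linear0 addr0.
have [b /= bE] : exists b : {linear L -> K2},
    forall x, i2 (b x) = lcomp (lsnd P1 P2) l x.
  by apply: (lift_ses i2e i2i) => x; rewrite -pq (ses_comp0 _ sl) linear0.
exists L, l, q, a, b; split=> //; split.
- move=> x y e; apply: i1i; have : l (a x) = l (a y) by rewrite e.
  by rewrite !aE /= => -[].
- move=> y; split=> [by0|[x <-]]; last first.
    by apply: i2i; rewrite bE /= aE /= linear0.
  have ly2 : (l y).2 = 0 by rewrite -bE by0 linear0.
  have [|x xE] := (i1e (l y).1).1.
    apply: ii; have := ses_comp0 y sl; rewrite /q /= ly2 !linear0 addr0 => ->.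
    by [].
  exists x; apply: li; rewrite aE /=.
  by apply: injective_projections; rewrite /= ?ly2.
- move=> y; have [|k kE] := (ie (f (i2 y))).1.
    by rewrite fE (ses_comp0 _ s2).
  have [x xE] := p1s k.
  have [|z zE] := (le (- x, i2 y)).1.
    by rewrite /q /= !linearN xE kE addNr.
  by exists z; apply: i2i; rewrite bE /= zE.
Qed.

Lemma horseshoe_ex K E X (i : {linear K -> E}) (p : {linear E -> X}) :
  short_exact i p ->
  exists K1 P1 (i1 : {linear K1 -> P1}) (p1 : {linear P1 -> K})
    K2 P2 (i2 : {linear K2 -> P2}) (p2 : {linear P2 -> X})
    L (l : {linear L -> dsum P1 P2}) (q : {linear dsum P1 P2 -> E})
    (a : {linear K1 -> L}) (b : {linear L -> K2}),
    [/\ projective P1 /\ short_exact i1 p1, projective P2 /\ short_exact i2 p2,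
        short_exact l q, short_exact a b & (forall x, l (a x) = linl P1 P2 (i1 x)) /\
        forall y, lsnd P1 P2 (l y) = i2 (b y)].
Proof.
move=> s.
have [K1 [P1 [i1 [p1 [hP1 s1]]]]] := presentation hR K.
have [K2 [P2 [i2 [p2 [hP2 s2]]]]] := presentation hR X.
have [L [l [q [a [b [sl sa la lb]]]]]] := horseshoe s s1 hP2 s2.
by exists K1, P1, i1, p1, K2, P2, i2, p2, L, l, q, a, b.
Qed.

Lemma Ext_contra_mid n K E X (i : {linear K -> E}) (p : {linear E -> X}) :
  short_exact i p -> ExtS n K F -> ExtS n X F -> ExtS n E F.
Proof.
elim: n K E X i p => [|n IH] K E X i p s hK hX;
  have [K1 [P1 [i1 [p1 [K2 [P2 [i2 [p2 [L [l [q [a [b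
    [[hP1 s1] [hP2 s2] sl sa [la lb]]]]]]]]]]]]]]] := horseshoe_ex s;
  have hP := dsum_projective hP1 hP2; last first.
  apply: (ExtS_syzygy hP sl); apply: IH sa (hK _ _ _ _ hP1 s1) (hX _ _ _ _ hP2 s2).
apply: (Ext1_proj hP sl) => g.
have [f fE] := hK _ _ _ _ s1 (lcomp g a); have [ai ae bs] := sa.
have [|r rE] := factor_ses (g := lsub g (lcomp (lcomp f (lfst P1 P2)) l)) ae bs.
  by move=> x; rewrite /= la /= fE /= subrr.
have [m mE] := hX _ _ _ _ s2 r.
exists (ladd (lcomp f (lfst P1 P2)) (lcomp m (lsnd P1 P2))) => y /=.
by rewrite -[(l y).2]/(lsnd P1 P2 (l y)) lb mE rE /= addrC subrK.
Qed.

Lemma Ext_contra_sub n K E X (i : {linear K -> E}) (p : {linear E -> X}) :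
  short_exact i p -> ExtS n E F -> ExtS n.+1 X F -> ExtS n K F.
Proof.
elim: n K E X i p => [|n IH] K E X i p s hE hX;
  have [K1 [P1 [i1 [p1 [K2 [P2 [i2 [p2 [L [l [q [a [b
    [[hP1 s1] [hP2 s2] sl sa [la lb]]]]]]]]]]]]]]] := horseshoe_ex s;
  have hP := dsum_projective hP1 hP2; last first.
  apply: (ExtS_syzygy hP1 s1); apply: IH sa (hE _ _ _ _ hP sl) (hX _ _ _ _ hP2 s2).
apply: (Ext1_proj hP1 s1) => g.
have [h hhE] := hX _ _ _ _ hP2 s2 _ _ _ _ sa g.
have [m mE] := hE _ _ _ _ sl h.
exists (lcomp m (linl P1 P2)) => x.
by rewrite -[LHS]/(m (linl P1 P2 (i1 x))) -la mE hhE.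
Qed.

Lemma Ext_contra_quot n K E X (i : {linear K -> E}) (p : {linear E -> X}) :
  short_exact i p -> ExtS n K F -> ExtS n.+1 E F -> ExtS n.+1 X F.
Proof.
elim: n K E X i p => [|n IH] K E X i p s hK hE;
  have [K1 [P1 [i1 [p1 [K2 [P2 [i2 [p2 [L [l [q [a [b
    [[hP1 s1] [hP2 s2] sl sa [la lb]]]]]]]]]]]]]]] := horseshoe_ex s;
  have hP := dsum_projective hP1 hP2; last first.
  apply: (ExtS_syzygy hP2 s2); apply: IH sa (hK _ _ _ _ hP1 s1) (hE _ _ _ _ hP sl).
apply: (ExtS_syzygy hP2 s2); apply: (Ext_contra_quot0 sa) (hE _ _ _ _ hP sl) => g.
have [h hhE] := hK _ _ _ _ s1 g.
by exists (lcomp h (lcomp (lfst P1 P2) l)) => x /=; rewrite la /= hhE.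
Qed.

End Contravariant.

Lemma ExtS_dsum n X X' Y : ExtS n X Y -> ExtS n X' Y -> ExtS n (dsum X X') Y.
Proof.
apply: (Ext_contra_mid (i := linl X X') (p := lsnd X X')); split.
- by move=> x y [].
- by move=> [x y]; split=> /= [->|[z [_ <-]] //]; exists x.
- by move=> y; exists (0, y).
Qed.

Lemma ExtS_injective n X I : injective_module I -> ExtS n X I.
Proof.
move=> hI; elim: n X => [|n IH] X; last by move=> K P i p hP s; exact: IH.
by move=> K E i p [ii _ _] g; exact: hI.
Qed.

End Ext.

(** * Ext from projective resolutions *)
Section Resolutions.
Variables (R : nzRingType) (hR : artin_category R).
Implicit Types X Y Z W K L E P Q B C I F U V N : fgmod R.

(** Dropping the first term of a projective resolution resolves the first syzygy.
    It is transparent so that cochains of the two resolutions can be identified. *)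
Definition shift_resolution X (P : proj_resolution X) K
    (i : {linear K -> res_ob P 0}) (g : {linear res_ob P 1 -> K})
    (ig : forall x, i (g x) = res_map P 0 x) (ie : exact_at i (res_aug P))
    (ii : injective i) : proj_resolution K.
Proof.
refine (@ProjResolution R K (fun n => res_ob P n.+1)
  (fun n => res_map P n.+1) g _ _ _ _).
- by move=> n; exact: res_proj.
- move=> k; have [|x xE] := (@res_exact0 _ _ P (i k)).1; first by apply/ie; exists k.
  by exists x; apply: ii; rewrite ig.
- move=> y; split=> [gy|/res_exactS]; first by apply/res_exactS; rewrite -ig gy linear0.
  by rewrite -ig => e; apply: ii; rewrite e linear0.
- by move=> n; exact: res_exactS.
Defined.

Definition cons_res_ob K P (Q : proj_resolution K) (n : nat) : fgmod R :=
  if n is m.+1 then res_ob Q m else P.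

Definition cons_resolution K P X (i : {linear K -> P}) (p : {linear P -> X})
    (hP : projective P) (s : short_exact i p) (Q : proj_resolution K) :
    proj_resolution X.
Proof.
refine (@ProjResolution R X (cons_res_ob P Q)
  (fun n => match n return {linear cons_res_ob P Q n.+1 -> cons_res_ob P Q n} with
            | 0 => lcomp i (res_aug Q)
            | m.+1 => res_map Q m end) p _ _ _ _).
- by case=> [|n] //; exact: res_proj.
- by case: s.
- case: s => ii ie _ y; split=> [/ie[k <-]|[x <-]].
    2: by apply/ie; exists (res_aug Q x).
  by have [x <-] := @res_surj _ _ Q k; exists x.
- case: s => ii ie _; case=> [|n] y; last exact: res_exactS.
  split=> [/= e|/(@res_exact0 _ _ Q _) /= ->]; last exact: linear0.
  by apply/res_exact0; apply: ii; rewrite e linear0.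
Defined.

Record cover X := Cover {
  cov_ker : fgmod R; cov_ob : fgmod R;
  cov_inj : {linear cov_ker -> cov_ob}; cov_map : {linear cov_ob -> X};
  cov_proj : projective cov_ob; cov_ses : short_exact cov_inj cov_map }.

(** Iterate a choice of presentations of all modules. *)
Lemma resolution_ex X : exists P : proj_resolution X, True.
Proof.
have c Y : cover Y.
  suff /cid[] : exists c : cover Y, True by [].
  by have [K [P [i [p [hP s]]]]] := presentation hR Y; exists (Cover hP s).
pose om n := iter n (fun Y => cov_ker (c Y)) X.
pose f n : {linear cov_ob (c (om n.+1)) -> cov_ob (c (om n))} :=
  lcomp (cov_inj (c (om n))) (cov_map (c (om n.+1))).
unshelve eexists (@ProjResolution R X (fun n => cov_ob (c (om n))) f
  (cov_map (c X)) _ _ _ _) => //.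
- by move=> n; exact: cov_proj.
- by case: (cov_ses (c X)).
- have [_ e _] := cov_ses (c X); have [_ _ s] := cov_ses (c (om 1)).
  move=> y; split=> [/e[k <-]|[x <-]]; last by apply/e; exists (cov_map (c (om 1)) x).
  by have [x <-] := s k; exists x.
- move=> n; have [_ e _] := cov_ses (c (om n.+1)).
  have [_ _ s] := cov_ses (c (om n.+2)).
  have [ii _ _] := cov_ses (c (om n)).
  move=> y; split=> [h|[x <-]]; last by rewrite /f /= (ses_comp0 _ (cov_ses _)) linear0.
  have /e[k <-] : cov_map (c (om n.+1)) y = 0 by apply: ii; rewrite linear0 -h.
  by have [x <-] := s k; exists x.
Qed.

(** Cocycles in degree n + 1 are maps from the (n + 1)-st syzygy, and both sides
    can be shifted down to the first syzygy. *)
Lemma Ext_zeroE n X Y : Ext_zero n.+1 X Y <-> ExtS n X Y.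
Proof.
split; elim: n X => [|n IH] X h.
- have [K [P [i [p [hP s]]]]] := presentation hR X; apply: (Ext1_proj hP s) => g.
  have [Q _] := resolution_ex K.
  have [|b bE] := h (cons_resolution hP s Q) (lcomp g (res_aug Q)).
    move=> x /=; rewrite (_ : res_aug Q _ = 0) ?linear0 //.
    by apply/res_exact0; exists x.
  by exists b => k; have [x <-] := @res_surj _ _ Q k; exact/esym/bE.
- move=> K P i p hP s; apply: IH => Q c cc.
  exact: (h (cons_resolution hP s Q) c cc).
- move=> P c cc; have [K [i [ii ie]]] := kernel_ex hR (res_aug P).
  have [g gE] : exists g : {linear res_ob P 1 -> K}, forall x, i (g x) = res_map P 0 x.
    by apply: (lift_ses ie ii) => x; apply/res_exact0; exists x.
  have gs : surj g.
    move=> k; have [|x xE] := (@res_exact0 _ _ P (i k)).1; first by apply/ie; exists k.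
    by exists x; apply: ii; rewrite gE.
  have [|r rE] := @factor_surj _ _ _ _ g c gs.
    move=> x gx; have [|y <-] := (@res_exactS _ _ P _ x).1; last exact: cc.
    by rewrite -gE gx linear0.
  have s : short_exact i (res_aug P) by split=> //; exact: res_surj.
  have [b bE] := h _ _ _ _ s r.
  by exists b => x; rewrite -gE bE rE.
- move=> P c cc; have [K [i [ii ie]]] := kernel_ex hR (res_aug P).
  have [g gE] : exists g : {linear res_ob P 1 -> K}, forall x, i (g x) = res_map P 0 x.
    by apply: (lift_ses ie ii) => x; apply/res_exact0; exists x.
  have s : short_exact i (res_aug P) by split=> //; exact: res_surj.
  exact: (IH K (h _ _ _ _ (@res_proj _ _ P 0) s) (shift_resolution gE ie ii) c cc).
Qed.

End Resolutions.

(** * Finite length and Krull-Schmidt *)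
Section Fitting.
Variables (R : nzRingType) (hR : artin_category R).
Implicit Types X Y Z W K L E P Q B C I F U V N : fgmod R.

Lemma ex_min (S : nat -> Prop) : (exists n, S n) ->
  exists n, S n /\ forall m, S m -> (n <= m)%N.
Proof.
move=> [n Sn]; have ex : exists n, `[< S n >] by exists n; apply/asboolP.
by case: (ex_minnP ex) => m /asboolP Sm mm; exists m; split=> // j /asboolP/mm.
Qed.

Lemma len_endo_inj X (f : {linear X -> X}) : injective f -> bijective f.
Proof.
by move=> fi; apply: inj_surj_bij => //; exact: len_inj_eq fi (leqnn (len hR X)).
Qed.

Lemma len_endo_surj X (f : {linear X -> X}) : surj f -> bijective f.
Proof.
by move=> fs; apply: inj_surj_bij => //; exact: len_surj_eq fs (leqnn (len hR X)).
Qed.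

Definition lpow X (h : {linear X -> X}) n : {linear X -> X} :=
  iter n (fun g => lcomp h g) (lid X).

Lemma lpowD X (h : {linear X -> X}) m n x : lpow h (m + n) x = lpow h m (lpow h n x).
Proof. by elim: m => //= m ->. Qed.

Lemma lpowSr X (h : {linear X -> X}) n x : lpow h n.+1 x = lpow h n (h x).
Proof. by rewrite -addn1 lpowD. Qed.

Lemma lpow_fix X (h : {linear X -> X}) n x : h x = x -> lpow h n x = x.
Proof. by move=> e; elim: n => //= n ->. Qed.

(** Fitting's lemma. The image of a power of h of least length is not shrunk by
    that power, hence is mapped bijectively onto itself. *)
Lemma fitting X (h : {linear X -> X}) :
  exists n I (e : {linear X -> I}) (i : {linear I -> X}),
    [/\ (0 < n)%N, surj e, injective i, forall x, i (e x) = lpow h n x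
      & bijective (lcomp e i)].
Proof.
pose S l := exists n I (e : {linear X -> I}) (i : {linear I -> X}),
    [/\ (0 < n)%N, surj e, injective i, forall x, i (e x) = lpow h n x
      & len hR I = l].
have [|l [[n [I [e [i [n0 es ii ie lI]]]]] min]] := @ex_min S.
  have [I [e [i [es ii ie]]]] := image_ex hR (lpow h 1).
  by exists (len hR I), 1%N, I, e, i.
exists n, I, e, i; split=> //; apply: len_endo_surj.
have [J [p [j [ps ji jp]]]] := image_ex hR (lcomp e (lcomp i e)).
have js : surj j.
  apply: (@len_inj_eq _ hR _ _ _ ji); rewrite lI; apply: min.
  exists (n + n)%N, J, p, (lcomp i j); split=> //.
  - by rewrite addn_gt0 n0.
  - by move=> x y /ii /ji.
  - by move=> x; rewrite lpowD -!ie /= jp.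
move=> y; have [z zE] := js y; have [x xE] := ps z.
by exists (e x); rewrite -zE -xE jp.
Qed.

Definition retract Y X : Prop :=
  exists (i : {linear Y -> X}) (p : {linear X -> Y}), forall y, p (i y) = y.

Lemma retract_trans X Y Z : retract X Y -> retract Y Z -> retract X Z.
Proof.
move=> [i [p e]] [j [q f]]; exists (lcomp j i), (lcomp p q) => x.
by rewrite /= f e.
Qed.

Lemma bij_retract X Y (f : {linear X -> Y}) : bijective f -> retract X Y /\ retract Y X.
Proof.
move=> /bij_linear_inv[g [fg gf]]; split; first by exists f, g.
by exists g, f.
Qed.

Lemma iso_retract X Y : iso X Y -> retract X Y.
Proof. by move=> [f /bij_retract[]]. Qed.

Lemma iso_sym X Y : iso X Y -> iso Y X.
Proof. by move=> [f /bij_linear_inv[g [fg gf]]]; exists g, f. Qed.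

Lemma iso_refl X : iso X X. Proof. by exists (lid X), id. Qed.

Lemma iso_trans X Y Z : iso X Y -> iso Y Z -> iso X Z.
Proof. by move=> [f bf] [g bg]; exists (lcomp g f); apply: bij_comp. Qed.

Lemma retract_split X Y (i : {linear Y -> X}) (p : {linear X -> Y}) :
  (forall y, p (i y) = y) ->
  exists K (j : {linear K -> X}), short_exact j p /\ iso X (dsum Y K).
Proof.
move=> e; have [|K [j s]] := @ses_kernel _ hR _ _ p; first by move=> y; exists (i y).
exists K, j; split=> //; have [ji je _] := s.
have [|q qE] := lift_ses (g := lsub (lid X) (lcomp i p)) je ji.
  by move=> x; rewrite /= linearB e subrr.
exists (lpair p q); apply: inj_surj_bij.
  apply: inj_ker0 => x [px qx]; have := qE x; rewrite qx linear0 /= px linear0 subr0.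
  by move<-.
move=> [y k]; exists (i y + j k); apply: injective_projections => /=.
  by rewrite linearD e (ses_comp0 _ s) addr0.
apply: ji; rewrite qE /= linearD e (ses_comp0 _ s) addr0 addrAC subrr add0r.
by [].
Qed.

Lemma dsummandE Y X : dsummand Y X <-> retract Y X.
Proof.
split=> [[Z [f /bij_linear_inv[g [fg gf]]]]|[i [p e]]].
  by exists (lcomp g (linl Y Z)), (lcomp (lfst Y Z) f) => y /=; rewrite gf.
by have [K [j [_ h]]] := retract_split e; exists K.
Qed.

(** By Fitting's lemma a is bijective or nilpotent, and in the latter case
    b = 1 - a is injective: the endomorphism ring is local. *)
Lemma indecomposable_local Y (a b : {linear Y -> Y}) : indecomposable Y ->
  (forall y, a y + b y = y) -> bijective a \/ bijective b.
Proof.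
move=> [nz dec] ab.
have [n [I [e [i [n0 es ii ie /bij_linear_inv[t [t1 t2]]]]]]] := fitting a.
have [|K [j [s h]]] := @retract_split Y I i (lcomp t e); first by move=> y; exact: t1.
case: (dec _ _ h) => [I0|K0].
  right; apply: len_endo_inj; apply: inj_ker0 => y by0.
  have ay : a y = y by rewrite -[RHS]ab by0 addr0.
  by rewrite -(lpow_fix n ay) -ie (I0 (e y)) linear0.
left; apply: len_endo_inj; apply: inj_ker0 => y ay.
have [_ je _] := s; have [|k <-] := (je y).1; last by rewrite (K0 k) linear0.
rewrite /= (_ : e y = 0) ?linear0 //; apply: ii; rewrite linear0 ie.
by case: n n0 {ie} => // n _; rewrite lpowSr ay linear0.
Qed.

Lemma retract_dsum Y X X' : indecomposable Y -> retract Y (dsum X X') ->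
  retract Y X \/ retract Y X'.
Proof.
move=> hY [i [p e]].
pose a := lcomp p (lcomp (linl X X') (lcomp (lfst X X') i)).
pose b := lcomp p (lcomp (linr X X') (lcomp (lsnd X X') i)).
have [|/bij_linear_inv[t [t1 t2]]|/bij_linear_inv[t [t1 t2]]] :=
  @indecomposable_local Y a b hY.
- move=> y; rewrite /a /b /= -linearD -[RHS]e; congr (p _).
  by apply: injective_projections; rewrite /= ?addr0 ?add0r.
- left; exists (lcomp (lfst X X') i), (lcomp t (lcomp p (linl X X'))) => y.
  exact: t1.
- right; exists (lcomp (lsnd X X') i), (lcomp t (lcomp p (linr X X'))) => y.
  exact: t1.
Qed.

Lemma retract_zero Y X : zero_mod X -> retract Y X -> zero_mod Y.
Proof. by move=> X0 [i [p e]] y; rewrite -[LHS]e (X0 (i y)) linear0. Qed.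

Lemma zero_mod0 : zero_mod (mod0 R).
Proof. by move=> x; apply/rowP; case. Qed.

Lemma retract_dsums Y (s : seq (fgmod R)) : indecomposable Y -> retract Y (dsums s) ->
  exists2 i, (i < size s)%N & retract Y (nth (mod0 R) s i).
Proof.
move=> hY; elim: s => [|X s IH] /= h.
  by case: hY => nz _; case: nz; apply: retract_zero zero_mod0 h.
have [r|/IH[i lt r]] := retract_dsum hY h; first by exists 0%N.
by exists i.+1.
Qed.

Lemma retract_iso Y X : indecomposable Y -> indecomposable X -> retract Y X -> iso Y X.
Proof.
move=> [nz _] [_ dec] [i [p e]]; have [K [j [s h]]] := retract_split e.
case: (dec _ _ h) => [/nz|K0] //; exists i; exists p => // x.
have [_ je _] := s; have [|k kE] := (je (x - i (p x))).1.
  by rewrite linearB e subrr.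
by apply/eqP; rewrite eq_sym -subr_eq0 -kE (K0 k) linear0.
Qed.

Lemma nth_retract_dsums (s : seq (fgmod R)) i : (i < size s)%N ->
  retract (nth (mod0 R) s i) (dsums s).
Proof.
elim: s i => [|X s IH] [|i] //= lt.
  by exists (linl X (dsums s)), (lfst X (dsums s)).
apply: retract_trans (IH i lt) _; by exists (linr X (dsums s)), (lsnd X (dsums s)).
Qed.

Lemma iso_dsum X X' Y Y' : iso X Y -> iso X' Y' -> iso (dsum X X') (dsum Y Y').
Proof.
move=> [f [g fg gf]] [f' [g' fg' gf']].
exists (lpair (lcomp f (lfst X X')) (lcomp f' (lsnd X X'))).
exists (fun z => (g z.1, g' z.2)) => -[x y] /=; by rewrite ?fg ?fg' ?gf ?gf'.
Qed.

Lemma iso_dsumCA X Y Z : iso (dsum X (dsum Y Z)) (dsum Y (dsum X Z)).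
Proof.
exists (lpair (lcomp (lfst Y Z) (lsnd X _))
  (lpair (lfst X _) (lcomp (lsnd Y Z) (lsnd X _)))).
by exists (fun t => (t.2.1, (t.1, t.2.2))) => -[x [y z]].
Qed.

Lemma iso_dsums_cat_cons (l r : seq (fgmod R)) X :
  iso (dsums (l ++ X :: r)) (dsum X (dsums (l ++ r))).
Proof.
elim: l => [|Y l IH] /=; first exact: iso_refl.
exact: iso_trans (iso_dsum (iso_refl Y) IH) (iso_dsumCA _ _ _).
Qed.

(** The entries that remain after removing X are re-indexed by the map b, which
    skips the position of X. *)
Lemma pairwise_noniso_drop (l r : seq (fgmod R)) X :
  pairwise_noniso_indec (l ++ X :: r) ->
  pairwise_noniso_indec (l ++ r) /\
  forall i, (i < size (l ++ r))%N -> ~ iso X (nth (mod0 R) (l ++ r) i).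
Proof.
move=> [ind uni].
pose b i := if (i < size l)%N then i else i.+1.
have bE i : nth (mod0 R) (l ++ r) i = nth (mod0 R) (l ++ X :: r) (b i).
  rewrite /b !nth_cat; case: ltnP => [->//|le].
  by rewrite ltnNge (leqW le) /= subSn.
have bs i : (i < size (l ++ r))%N -> (b i < size (l ++ X :: r))%N.
  rewrite /b !size_cat /= addnS; case: ifP => _ // h; exact: leqW.
have bX i : b i <> size l.
  rewrite /b; case: ltnP => [lt e|le e]; first by rewrite e ltnn in lt.
  by rewrite -e ltnn in le.
split; last first.
  move=> i lt h; apply: (bX i); apply: uni; first exact: bs.
    by rewrite size_cat /= addnS ltnS leq_addr.
  by rewrite -(bE i) [Z in iso _ Z]nth_cat ltnn subnn /=; apply: iso_sym.
split=> [i lt|i j li lj]; first by rewrite bE; apply: ind; exact: bs.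
rewrite !bE => h; have := uni _ _ (bs _ li) (bs _ lj) h; rewrite /b.
case: ltnP => hi; case: ltnP => hj // e.
- by move: hi; rewrite e => /ltnW; rewrite leqNgt ltnS hj.
- by move: hj; rewrite -e => /ltnW; rewrite leqNgt ltnS hi.
- by case: e.
Qed.

Lemma nth_split (s : seq (fgmod R)) i : (i < size s)%N ->
  exists l r, s = l ++ nth (mod0 R) s i :: r /\ size l = i.
Proof.
move=> lt; exists (take i s), (drop i.+1 s).
by rewrite -drop_nth // cat_take_drop size_take lt.
Qed.

(** By induction on s: remove the head of s together with the entry of t
    isomorphic to it; having no repetitions, the remaining lists still have
    matching entries. *)
Lemma basic_unique (s t : seq (fgmod R)) :
  pairwise_noniso_indec s -> pairwise_noniso_indec t ->
  (forall i, (i < size s)%N ->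
     exists2 j, (j < size t)%N & iso (nth (mod0 R) s i) (nth (mod0 R) t j)) ->
  (forall j, (j < size t)%N ->
     exists2 i, (i < size s)%N & iso (nth (mod0 R) t j) (nth (mod0 R) s i)) ->
  iso (dsums s) (dsums t).
Proof.
elim: s t => [|X s IH] t hs ht st ts.
  case: t ht ts {st} => [|Y t] ht ts; first exact: iso_refl.
  by have [i] := ts 0%N isT.
have [j lt /= hj] := st 0%N isT.
have [l [r [e sl]]] := nth_split lt; move: hj e; set Y := nth _ t j => hj e.
rewrite e; apply: iso_trans _ (iso_sym (iso_dsums_cat_cons _ _ _)).
apply: iso_dsum => //.
rewrite e in ht ts st; have [hs' nX] := @pairwise_noniso_drop [::] s X hs.
have [ht' nY] := pairwise_noniso_drop ht.
have Yj : nth (mod0 R) (l ++ Y :: r) (size l) = Y by rewrite nth_cat ltnn subnn.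
apply: IH => // i li.
  have [k lk h] := st i.+1 li; rewrite /= in h.
  have nk : k <> size l.
    move=> ek; apply: (nX i li) => /=; apply: iso_trans hj _.
    by apply: iso_sym; rewrite -Yj -ek.
  move: lk h; rewrite size_cat /= addnS nth_cat.
  case: (ltngtP k (size l)) => [lt' lk|gt lk|//] h.
    by exists k; rewrite ?size_cat ?nth_cat ?lt' // ltn_addr.
  case: k gt lk h {nk} => // k gt lk; rewrite subSn //= => h.
  exists k; first by rewrite size_cat.
  by rewrite nth_cat ltnNge -ltnS gt.
pose b := if (i < size l)%N then i else i.+1.
have bE : nth (mod0 R) (l ++ r) i = nth (mod0 R) (l ++ Y :: r) b.
  rewrite /b !nth_cat; case: ltnP => [->//|le].
  by rewrite ltnNge (leqW le) /= subSn.
have [|k lk h] := ts b.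
  move: li; rewrite /b !size_cat /= addnS; case: ifP => _ // hh; exact: leqW.
case: k lk h => [|k] lk h; last by exists k => //; rewrite bE.
case: (nY i li); apply: iso_trans (iso_sym hj) _; apply: iso_sym.
by rewrite bE.
Qed.

End Fitting.

(** * Projective covers and minimal approximations *)
Section Minimal.
Variables (R : nzRingType) (hR : artin_category R).
Implicit Types X Y Z W K L E P Q B C I F U V N : fgmod R.

Lemma retract_projective P Q : retract Q P -> projective P -> projective Q.
Proof.
move=> [i [r e]] hP X Y p f ps; have [g gE] := hP _ _ p (lcomp f r) ps.
by exists (lcomp g i) => x; rewrite /= gE /= e.
Qed.

(** Among the projective modules mapping onto X take P of least length. If L -> P
    still maps onto X, then p lifts to an endomorphism of P over X that factors
    through L; by Fitting's lemma the image of one of its powers is a projective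
    module mapping onto X, hence all of P. *)
Lemma projective_cover X : exists P (p : {linear P -> X}),
  [/\ projective P, surj p
    & forall L (l : {linear L -> P}), surj (lcomp p l) -> surj l].
Proof.
pose S n := exists P (p : {linear P -> X}), [/\ projective P, surj p & len hR P = n].
have [|n [[P [p [hP ps lP]]] min]] := @ex_min S.
  have [m [p ps]] := free_cover X; exists (len hR (free_mod R m)), (free_mod R m), p.
  by split=> //; exact: free_projective.
exists P, p; split=> // L l pls; have [f fE] := hP _ _ _ p pls.
have [m [I [e [i [m0 es ii ie /bij_linear_inv[t [t1 t2]]]]]]] := fitting hR (lcomp l f).
have rI : retract I P by exists i, (lcomp t e) => y; exact: t1.
have is_ : surj i.
  apply: (@len_inj_eq _ hR _ _ _ ii); rewrite lP; apply: min; exists I, (lcomp p i).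
  split=> //; first exact: retract_projective rI hP.
  move=> x; have [y <-] := ps x; exists (e y); rewrite /= ie.
  by elim: m {m0 ie} => //= m IH; rewrite -[LHS]/(lcomp p l (f _)) fE.
move=> y; have [z zE] := is_ y; have [x xE] := es z.
have : lpow (lcomp l f) m x = y by rewrite -ie xE.
by case: m m0 {ie} => // m _ /= <-; exists (f (lpow (lcomp l f) m x)).
Qed.

(** A left approximation whose target has least length is minimal, because the
    image of an endomorphism under X is again the target of an approximation. *)
Lemma min_left_approx (T : subcat R) X :
  (forall Y Z (f : {linear Y -> Z}), surj f -> T Y -> T Z) ->
  (exists U (f : {linear X -> U}), left_approx T f) ->
  exists U (f : {linear X -> U}), left_approx T f /\ left_minimal f.
Proof.
move=> quo [U0 [f0 ap0]].
pose S n := exists U (f : {linear X -> U}), left_approx T f /\ len hR U = n.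
have [|n [[U [f [[TU ap] lU]]] min]] := @ex_min S; first by exists (len hR U0), U0, f0.
exists U, f; split=> // h hf; have [I [p [j [ps ji jp]]]] := image_ex hR h.
have le : (len hR U <= len hR I)%N.
  rewrite lU; apply: min; exists I, (lcomp p f); split=> //.
  split; first exact: quo ps TU.
  move=> V g TV; have [g' g'E] := ap V g TV; exists (lcomp g' j) => x /=.
  by rewrite jp hf g'E.
apply: inj_surj_bij => [x y|y].
  by rewrite -!jp => /ji; exact: (@len_surj_eq _ hR _ _ _ ps le).
have [z <-] := @len_inj_eq _ hR _ _ _ ji le y; have [x <-] := ps z.
by exists x; rewrite jp.
Qed.

End Minimal.

(** * Torsion in a d-cluster tilting subcategory *)
Section Torsion.
Variables (R : nzRingType) (hR : artin_category R) (d : nat).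
Implicit Types X Y Z W K L E P Q B C I F U V N D S tN tI UN : fgmod R.
Variables (M T : subcat R).
Hypotheses (hd : (1 <= d)%N) (hM : d_cluster_tilting d M) (hT : torsion_class T)
  (hTff : functorially_finite T) (hTM : induces_d_torsion_class d M T).

Local Notation U := (cap T M).

Lemma T_quot X Y (f : {linear X -> Y}) : surj f -> T X -> T Y.
Proof. by case: hT => _ + _; apply. Qed.

Lemma T_extension X Y Z (f : {linear X -> Y}) (g : {linear Y -> Z}) :
  short_exact f g -> T X -> T Z -> T Y.
Proof. by case: hT => _ _; apply. Qed.

Lemma T_retract X Y : retract Y X -> T X -> T Y.
Proof. by move=> [i [p e]]; apply: (T_quot (f := p)) => y; exists (i y). Qed.

Lemma M_retract X Y : retract Y X -> M X -> M Y.
Proof. by case: hM => -[_ _ _ h] _ _ _ /(dsummandE hR); exact: h. Qed.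

Lemma M_ext X N n : M X -> M N -> (n.+1 < d)%N -> ExtS n X N.
Proof. by case: hM => _ _ h _ /h hX /hX{}hX lt; apply/(Ext_zeroE hR)/hX. Qed.

Lemma M_left X : (forall N, M N -> forall n, (n.+1 < d)%N -> ExtS n X N) -> M X.
Proof.
case: hM => _ _ h _ hX; apply/h => N /hX{}hX [//|n] lt.
by apply/(Ext_zeroE hR)/hX.
Qed.

Lemma M_right Y : (forall N, M N -> forall n, (n.+1 < d)%N -> ExtS n N Y) -> M Y.
Proof.
case: hM => _ _ _ h hX; apply/h => N /hX{}hX [//|n] lt.
by apply/(Ext_zeroE hR)/hX.
Qed.

Lemma M_projective P : projective P -> M P.
Proof. by move=> hP; apply: M_left => N _ n _; exact: projective_ExtS. Qed.

Lemma M_injective I : injective_module I -> M I.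
Proof. by move=> hI; apply: M_right => N _ n _; exact: ExtS_injective. Qed.

(** M contains the projective modules, so its right approximations are onto; since
    it contains the injective ones, its left approximations are injective. *)
Lemma right_M_approx X : exists N (f : {linear N -> X}), right_approx M f /\ surj f.
Proof.
case: hM => _ /(_ X)[_ [N [f [MN ap]]]] _ _; exists N, f; split=> //.
have [n [p ps]] := free_cover X.
have [h hE] := ap _ p (M_projective (@free_projective R n)).
by move=> x; have [y <-] := ps x; exists (h y).
Qed.

Lemma left_M_approx_inj X N (f : {linear X -> N}) : left_approx M f -> injective f.
Proof.
move=> [MN ap]; have [I [i [ii hI]]] := enough_injectives hR X.
by have [h hE] := ap _ i (M_injective hI) => x y e; apply: ii; rewrite -!hE e.
Qed.

(** tN is the image of a right T-approximation of N. If X in T maps to N/tN, the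
    preimage of its image is an extension of torsion modules, so it is contained in
    tN. *)
Lemma torsion_ex N : exists tN (j : {linear tN -> N}), torsion_subobject T j.
Proof.
have [_ [V [g [TV ap]]]] := hTff N.
have [I [p [i [ps ii ip]]]] := image_ex hR g; have [C [q s]] := ses_coker ii.
exists I, i; split; first exact: T_quot ps TV.
exists C, q; split=> // X h TX; have [J [a [b [as_ bi ba]]]] := image_ex hR h.
have [ie qs] : exact_at i q /\ surj q by case: s.
have [B [al [be [ab ex un]]]] := pullback_ex hR q b.
have [|k kE] := pullback_map (u := i) (v := lzero I J) ex un.
  by move=> w; rewrite (ses_comp0 _ s) linear0.
have bs : surj be.
  by move=> y; have [n nE] := qs (b y); have [t [_ <-]] := ex _ _ nE; exists t.
have sB : short_exact k be.
  split=> //.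
  - by move=> x y e; apply: ii; rewrite -(kE x).1 e (kE y).1.
  - move=> t; split=> [bt|[y <-]]; last by case: (kE y).
    have [|y ye] := (ie (al t)).1; first by rewrite ab bt linear0.
    exists y; apply/eqP; rewrite -subr_eq0; apply/eqP/un.
      by rewrite linearB (kE y).1 ye subrr.
    by rewrite linearB (kE y).2 bt subr0.
have TB : T B := T_extension sB (T_quot ps TV) (T_quot as_ TX).
have [r rE] := ap _ al TB.
move=> x; rewrite -ba; have [t <-] := bs (a x).
by rewrite -ab -rE -ip (ses_comp0 _ s).
Qed.

(** The properties of the quotients N/tN, N in M, that are used; they pass to direct
    summands, which the class of these quotients itself need not. *)
Definition tf_orthogonal F : Prop :=
  [/\ forall X (g : {linear X -> F}), T X -> forall x, g x = 0,
      forall X, U X -> forall n, (n.+1 < d)%N -> ExtS n X F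
    & forall N, M N -> forall n, (n.+2 < d)%N -> ExtS n N F].

Lemma tf_orthogonal_retract F F' : retract F' F -> tf_orthogonal F -> tf_orthogonal F'.
Proof.
move=> [i [p e]] [h1 h2 h3]; split.
- by move=> X g TX x; rewrite -[LHS]e -[i _]/(lcomp i g x) h1 ?linear0.
- by move=> X UX n lt; apply: ExtS_retract2 e _; exact: h2.
- by move=> X UX n lt; apply: ExtS_retract2 e _; exact: h3.
Qed.

Section Seq.
Variables (X : fgmod R) (UX : U X) (V : mod_seq R).
Hypotheses (VM : forall j, (j < d)%N -> M (V j))
  (Vex : forall i (v : V i.+1), (i.+1 < d)%N ->
     ((i.+2 < d)%N -> seq_map V i.+1 v = 0) <-> exists y, seq_map V i y = v)
  (Vhom : hom_exact_seq d.-1 X V).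

(** Dimension shifting along L -> V_i -> V_(i+1) -> ...: the V_j have no extensions
    by X in U in degrees below d, and at the end of the sequence maps from X lift
    because Hom(X, -) is exact on it. *)
Lemma cokernel_sequence_ExtS n i L (l : {linear L -> V i}) : injective l ->
  (forall v, seq_map V i v = 0 <-> exists x, l x = v) ->
  (i + n.+1 < d)%N -> ExtS n X L.
Proof.
have MX : M X by case: UX.
elim: n i L l => [|n IH] i L l li le lt;
  have [D [p [j [ps ji jp]]]] := image_ex hR (seq_map V i).
all: have s : short_exact l p.
1,3: split=> // v; rewrite -le -jp; split=> [->|e]; first exact: linear0.
1,2: by apply: ji; rewrite e linear0.
- apply: (Ext_cov_sub0 s); last by apply: (@M_ext _ _ 0) => //; [apply: VM|]; lia.
  have le1 : (i.+1 <= d.-1)%N by lia.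
  move=> g; have [|h hE] := (@Vhom i.+1 (lcomp j g) le1).1.
    have lt1 : (i.+1 < d)%N by lia.
    move=> lt' x; apply: ((@Vex i (j (g x)) lt1).2 _); last by lia.
    by have [y <-] := ps (g x); exists y; rewrite jp.
  by exists h => x; apply: ji; rewrite jp hE.
- apply: (Ext_cov_sub s); last by apply: M_ext => //; [apply: VM|]; lia.
  apply: (IH i.+1 D j ji) => [v|]; last by lia.
  have lt2 : (i.+2 < d)%N by lia.
  split=> [e|[x <-]].
    by have [|y <-] := (@Vex _ v (ltnW lt2)).1 => //; exists (p y); rewrite jp.
  apply: ((@Vex i (j x) (ltnW lt2)).2 _) => //.
  by have [y <-] := ps x; exists y; rewrite jp.
Qed.
End Seq.

(** The torsion subobject of N in M coincides with the d-torsion subobject, so it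
    lies in M and its cokernel starts a sequence as in [cokernel_sequence_ExtS]. *)
Lemma torsion_M N : M N -> exists tN F (t : {linear tN -> N}) (f : {linear N -> F}),
  [/\ short_exact t f, U tN & tf_orthogonal F].
Proof.
move=> MN; have [[_ _ hN] same] := hTM.
have [UN [i hi]] := hN _ MN.
have [tN [j hj]] := torsion_ex N.
have ij := same _ _ _ _ _ MN hi hj.
have [UUN MUN [V [p [VM Vex Vhom]]]] := hi.
have ii : injective i.
  by apply: inj_ker0 => x ix; exact: (Vex 0%N x isT).1.
have [F [q s]] := ses_coker ii; have [_ ie qs] := s.
have tU : tf_orthogonal F; last by exists UN, F, i, q.
have hU : forall X, U X -> forall n, (n.+1 < d)%N -> ExtS n X F.
  move=> X UX n lt; have d2 : (1 < d)%N by lia.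
  have pe n' : p n' = 0 <-> exists x, i x = n'.
    have H := Vex 1%N n' isT; split=> [e|h]; first by apply: H.1 => _.
    exact: H.2 h hd.
  have [|m mE] := factor_ses (g := p) ie qs.
    by move=> x; apply/pe; exists x.
  apply: (@cokernel_sequence_ExtS X UX V VM _ (Vhom X UX) n 0 F m).
  - move=> k v lt'; have H := Vex k.+3 v lt'; split=> [h|h h']; last exact: H.2 h h'.
    by apply: H.1.
  - apply: inj_ker0 => x; have [y <-] := qs x; rewrite mE => /pe[z <-].
    by rewrite (ses_comp0 _ s).
  - move=> v; have H := Vex 2%N v hd.
    split=> [e|[x <-]].
      by have [y <-] := H.1 (fun _ => e); exists (q y); rewrite mE.
    apply: ((Vex 2%N (m x) hd).2 _ d2).
    by have [y <-] := qs x; exists y; rewrite mE.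
  - by lia.
split=> //; last first.
  move=> N' MN' n lt; apply: (Ext_cov_quot hR s); first by apply: M_ext => //; lia.
  by apply: M_ext.
have [_ [V' [p' [s' H]]]] := hj; have [_ je' _] := s'.
move=> X g TX x.
have [|m mE] := factor_ses (g := p') ie qs.
  by move=> y; apply/je'/ij; exists y.
have : m (g x) = 0 by exact: (H _ (lcomp m g) TX x).
have [y <-] := qs (g x); rewrite mE => /je'/ij[z <-].
exact: ses_comp0 s.
Qed.

(** An exact sequence 0 -> E_m -> ... -> E_0 -> Z -> 0 with all E_j in U, cut into
    short exact sequences. *)
Fixpoint chain m Z : Prop :=
  if m is m'.+1 then
    exists K E (i : {linear K -> E}) (p : {linear E -> Z}),
      [/\ short_exact i p, U E & chain m' K]
  else U Z.

Lemma chain_T m Z : chain m Z -> T Z.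
Proof.
case: m => [[]//|m] [K [E [i [p [[_ _ ps] [TE _] _]]]]]; exact: T_quot ps TE.
Qed.

Lemma chain_bij m Z Z' (f : {linear Z -> Z'}) : bijective f -> chain m Z -> chain m Z'.
Proof.
move=> bf; case: m => [[TZ MZ]|m [K [E [i [p [[ii ie ps] UE hK]]]]]].
  by have [_ r] := bij_retract bf; split; [exact: T_retract r TZ|exact: M_retract r MZ].
have [g [fg gf]] := bij_linear_inv bf.
exists K, E, i, (lcomp f p); split=> //; split=> //.
  move=> e; split=> [/= h|/ie /= ->]; last exact: linear0.
  by apply/ie; apply: (can_inj fg); rewrite h linear0.
by move=> z; have [e eE] := ps (g z); exists e; rewrite /= eE gf.
Qed.

Lemma chain_orthogonal m Z F n :
  chain m Z -> tf_orthogonal F -> (n.+1 < d)%N -> ExtS n Z F.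
Proof.
elim: m Z n => [|m IH] Z n; first by move=> UZ [_ h _]; exact: h.
move=> [K [E [i [p [s UE hK]]]]] hF lt; have [F1 F2 _] := hF.
case: n lt => [|n] lt.
  apply: (Ext_contra_quot0 hR s); last exact: (F2 _ UE 0%N).
  by move=> g; exists (lzero _ _) => x; rewrite (F1 _ g (chain_T hK)).
apply: (Ext_contra_quot hR s); last exact: F2.
by apply: IH hF _ => //; exact: ltnW.
Qed.

(** A resolution of K by objects of M is cut down to torsion submodules. Let K'
    be the kernel of an M-approximation N -> K, with torsion-free quotient F2.
    The hypothesis on Ext^1(K, F2) extends K' -> F2 to N, which makes F2 a direct
    summand of N/tN. The complement K0 is then the torsion-free quotient of K, and
    the torsion parts of K', N and K form a short exact sequence. The bounds on the
    degrees are what remains available after the first syzygies. *)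
Lemma torsion_resolution m K : (m < d)%N ->
  (forall N, M N -> forall n, (n.+1 + m < d)%N -> ExtS n N K) ->
  (forall F, tf_orthogonal F -> forall n, (n < m)%N -> ExtS n K F) ->
  exists Z F (i : {linear Z -> K}) (p : {linear K -> F}),
    [/\ short_exact i p, chain m Z & tf_orthogonal F].
Proof.
elim: m K => [|m IH] K lt hN hF.
  have MK : M K by apply: M_right => N MN n ln; apply: hN => //; rewrite addn0.
  by have [tN [F [t [f [s hU hFc]]]]] := torsion_M MK; exists tN, F, t, f.
have [N [q [[MN ap] qs]]] := right_M_approx K.
have [K' [i s]] := ses_kernel hR qs; have [ii ie _] := s.
have [||T2 [F2 [a [b [sab chT2 hF2]]]]] := IH K' (ltnW lt).
- move=> N' MN' [|n] ln.
    apply: (Ext_cov_sub0 s); last by apply: (@M_ext _ _ 0) => //; lia.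
    by move=> g; exact: ap.
  apply: (Ext_cov_sub s); last by apply: M_ext => //; lia.
  by apply: hN => //; lia.
- move=> F hFF n ln; apply: (Ext_contra_sub hR s).
    by have [_ _ h] := hFF; apply: h => //; lia.
  by apply: hF => //; lia.
have [F2T _ _] := hF2; have [ai ae bs] := sab.
have [tN [F1 [t [f [st UtN hF1]]]]] := torsion_M MN; have [ti te fs] := st.
have [be beE] := hF _ hF2 0%N isT _ _ _ _ s b.
have [|ga gaE] := factor_ses (g := be) te fs.
  move=> x; exact: (F2T _ (lcomp be t) UtN.1).
have [F1T _ _] := hF1.
have [|de deE] := factor_ses (g := lcomp f i) ae bs.
  by move=> x; exact: (F1T _ (lcomp (lcomp f i) a) (chain_T chT2)).
(* F2 -> F1 -> F2 is the identity, so F1 = F2 + K0. *)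
have gade y : ga (de y) = y.
  by have [x <-] := bs y; rewrite deE /= gaE beE.
have [K0 [j [sj iK0]]] := retract_split hR gade; have [ji je gs] := sj.
have [|pi piE] := lift_ses (g := lsub (lid F1) (lcomp de ga)) je ji.
  by move=> x; rewrite /= linearB gade subrr.
have hK0 : tf_orthogonal K0.
  apply: tf_orthogonal_retract hF1; exists j, pi => y; apply: ji.
  by rewrite piE /= (ses_comp0 _ sj) linear0 subr0.
have pide y : pi (de y) = 0 by apply: ji; rewrite piE /= gade subrr linear0.
(* The projection of N/tN to K0 kills K' and descends to K. *)
have [|rho rhoE] := factor_ses (g := lcomp pi f) ie qs.
  by move=> x; rewrite /= -[f (i x)]/(lcomp f i x) -deE pide.
have rqt x : rho (q (t x)) = 0 by rewrite rhoE /= (ses_comp0 _ st) linear0.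
have [T' [e [io [es ioi ioe]]]] := image_ex hR (lcomp q t).
exists T', K0, io, rho; split=> //.
  split=> //.
    move=> k; split=> [rk|[z <-]]; last by have [x <-] := es z; rewrite ioe /= rqt.
    have [n nE] := qs k; have fn : f n = de (ga (f n)).
      apply/eqP; rewrite -subr_eq0 -[X in X == 0]piE.
      by rewrite -[pi _]/(lcomp pi f n) -rhoE nE rk linear0.
    have [k' k'E] := bs (ga (f n)).
    have [|x xE] := (te (n - i k')).1.
      by rewrite linearB fn -[f (i k')]/(lcomp f i k') -deE k'E subrr.
    exists (e x); rewrite ioe /= xE linearB (ses_comp0 _ s) subr0 //.
  move=> y; have [n nE] := fs (j y); exists (q n); rewrite rhoE /= nE.
  by apply: ji; rewrite piE /= (ses_comp0 _ sj) linear0 subr0.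
have [|sg sgE] := lift_ses (g := lcomp i a) te ti.
  by move=> x; rewrite /= -[f (i _)]/(lcomp f i (a x)) -deE (ses_comp0 _ sab) linear0.
exists T2, tN, sg, e; split=> //; split=> //.
- by move=> x y h; apply: ai; apply: ii; have := congr1 t h; rewrite !sgE.
- move=> x; split=> [ex|[y <-]]; last first.
    by apply: ioi; rewrite ioe /= sgE /= (ses_comp0 _ s) linear0.
  have [|k' k'E] := (ie (t x)).1; first by rewrite -[LHS]/(lcomp q t x) -ioe ex linear0.
  have [|y yE] := (ae k').1.
    by rewrite -[LHS]gade deE /= k'E (ses_comp0 _ st) linear0.
  by exists y; apply: ti; rewrite sgE /= yE.
Qed.

(** X has no nonzero map to the torsion-free quotient of N, and the torsion part of N
    lies again in M, so the approximation can be corestricted to it. *)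
Lemma left_approx_torsion X N (f : {linear X -> N}) : left_approx M f -> T X ->
  exists E (g : {linear X -> E}) (t : {linear E -> N}),
    [/\ U E, left_approx M g, injective t & forall x, t (g x) = f x].
Proof.
move=> [MN ap] TX; have [tN [F [t [p [s hU hF]]]]] := torsion_M MN.
have [ti te _] := s; have [hFT _ _] := hF.
have [|g gE] := lift_ses (g := f) te ti; first by move=> x; exact: (hFT _ (lcomp p f)).
exists tN, g, t; split=> //; split; first by case: hU.
move=> V h MV; have [k kE] := ap _ h MV.
by exists (lcomp k t) => x /=; rewrite gE kE.
Qed.

Lemma left_U_approx X : T X ->
  exists E C (f : {linear X -> E}) (q : {linear E -> C}),
    [/\ U E, left_approx M f & short_exact f q].
Proof.
move=> TX; case: hM => _ /(_ X)[[N [f ap]] _] _ _.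
have [E [g [t [UE apg _ _]]]] := left_approx_torsion ap TX.
have [C [q s]] := ses_coker (left_M_approx_inj apg).
by exists E, C, g, q.
Qed.

(** By minimality N is a direct summand of the torsion part E of N. *)
Lemma left_minimal_U X N (f : {linear X -> N}) : left_approx M f -> left_minimal f ->
  T X -> U N.
Proof.
move=> ap mi TX; have [E [g [t [[TE ME] apg ti tg]]]] := left_approx_torsion ap TX.
have [h hE] := ap.2 _ g ME; split; last by case: ap.
apply: (T_retract _ TE); have [|r [r1 r2]] := @bij_linear_inv _ _ _ (lcomp t h).
  by apply: mi => x /=; rewrite hE tg.
by exists (lcomp h r), t.
Qed.

(** * Ext^d-projectivity of the terms of the coresolution *)

(** One step C -> N -> C' of the minimal coresolution. The hypothesis on Ext^1(C, -)
    is the invariant of the induction; it is re-established for C' at the end. *)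
Section Step.
Variables (C N C' : fgmod R) (f : {linear C -> N}) (q : {linear N -> C'}).
Hypotheses (TC : T C) (C_Ext : forall m K, (m < d)%N -> chain m K -> Ext1 C K)
  (ap : left_approx M f) (mi : left_minimal f) (s : short_exact f q).

Lemma target_U : U N. Proof. exact: left_minimal_U ap mi TC. Qed.

Lemma approx_extends_chain m K (g : {linear C -> K}) : (m < d)%N -> chain m K ->
  exists h : {linear N -> K}, forall x, h (f x) = g x.
Proof.
case: m => [|m] lt hK; first by apply: ap.2; case: hK.
case: hK => K' [E [i [p [sK [_ ME] hK']]]].
have [l lE] := Ext1_lift hR (C_Ext (ltnW lt) hK') sK g.
have [h hE] := ap.2 _ l ME.
by exists (lcomp p h) => x; rewrite /= hE.
Qed.

(** For an extension B of N by Z, the map C -> N lifts to B by the invariant. B is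
    torsion, hence resolved by U as it has no extensions by the torsion-free
    quotients; so the lift extends to N -> B, and minimality of C -> N makes the
    composite N -> B -> N invertible. *)
Lemma target_Ext1 Z : chain d.-1 Z -> Ext1 N Z.
Proof.
have ld : (d.-1 < d)%N by lia.
move=> hZ; apply: lift_Ext1 => B i p sB; have [TN MN] := target_U.
have [l lE] := Ext1_lift hR (C_Ext ld hZ) sB f.
have TB : T B := T_extension sB (chain_T hZ) TN.
have hB : chain d.-1 B.
  have [||Z' [F [j [r [[ji je rs] hZ' [FT _ _]]]]]] := @torsion_resolution d.-1 B ld.
  - by move=> N' _ n; lia.
  - move=> F hF n ln; apply: (Ext_contra_mid hR sB).
      by apply: chain_orthogonal hZ hF _; lia.
    by have [_ h _] := hF; apply: h target_U _ _; lia.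
  apply: (chain_bij _ hZ'); apply: inj_surj_bij ji _ => b.
  by apply/je; exact: FT.
have [h hE] := approx_extends_chain l ld hB.
have [|r [r1 r2]] := @bij_linear_inv _ _ _ (lcomp p h).
  by apply: mi => x /=; rewrite hE lE.
by exists (lcomp h r) => x; exact: r2.
Qed.

(** Embed Z in the torsion part tI of an injective module I: the cokernel has a
    resolution one step longer, while Ext^j(N, tI) = 0 for 0 < j <= d because
    Ext^(j-1)(N, I/tI) and Ext^j(N, I) vanish. This reduces to [target_Ext1]. *)
Lemma target_ExtS e m Z : (e + m = d.-1)%N -> chain m Z -> ExtS e N Z.
Proof.
elim: e m Z => [|e IH] m Z em hZ; first by apply: target_Ext1; rewrite -em.
have [I [i [ii hI]]] := enough_injectives hR Z.
have [tI [F [t [p [st UtI hF]]]]] := torsion_M (M_injective hI).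
have [ti te _] := st; have [FT FU _] := hF.
have [|j jE] := lift_ses (g := i) te ti.
  by move=> x; exact: (FT _ (lcomp p i) (chain_T hZ)).
have ji : injective j by move=> x y e'; apply: ii; rewrite -!jE e'.
have [Z' [r sj]] := ses_coker ji.
apply: (Ext_cov_sub sj).
  by apply: (IH m.+1); [lia|exists Z, tI, j, r].
apply: (Ext_cov_sub st); last exact: ExtS_injective.
by apply: FU target_U _ _; lia.
Qed.

Lemma target_Ext_top Y : U Y -> ExtS d.-1 N Y.
Proof. by apply: (@target_ExtS d.-1 0); rewrite addn0. Qed.

Lemma target_Ext_U n Y : U Y -> (n < d)%N -> ExtS n N Y.
Proof.
move=> UY lt; have [e|ne] := eqVneq n d.-1.
  by rewrite e; exact: target_Ext_top.
by apply: M_ext; [case: target_U|case: UY|lia].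
Qed.

Lemma target_Ext_chain m n Z : chain m Z -> (n + m < d)%N -> ExtS n N Z.
Proof.
elim: m n Z => [|m IH] n Z hZ lt.
  by apply: target_Ext_U => //; lia.
case: hZ => K [E [i [p [sK UE hK]]]].
apply: (Ext_cov_quot hR sK); last by apply: IH => //; lia.
by apply: target_Ext_U => //; lia.
Qed.

Lemma cokernel_invariant : T C' /\ forall m K, (m < d)%N -> chain m K -> Ext1 C' K.
Proof.
have [TN _] := target_U; have [_ _ qs] := s; split; first exact: T_quot qs TN.
move=> m K lt hK; apply: (Ext_contra_quot0 hR s) => [g|].
  exact: approx_extends_chain lt hK.
by apply: (target_Ext_chain (n := 0) hK).
Qed.
End Step.

Lemma coresolution_Ext_projective us C : min_coresolution M C us -> T C ->
  (forall m K, (m < d)%N -> chain m K -> Ext1 C K) ->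
  forall i, (i < size us)%N -> Ext_projective d U (nth (mod0 R) us i).
Proof.
elim: us C => [|N us IH] C //= [f [C' [q [ap mi s co]]]] TC hC [|i] lt /=.
  split; first exact: target_U ap mi.
  move=> Y UY; rewrite -(prednK hd); apply/(Ext_zeroE hR).
  exact: (target_Ext_top TC hC ap mi UY).
by have [TC' hC'] := cokernel_invariant TC hC ap mi s; exact: IH C' co TC' hC' i lt.
Qed.

End Torsion.

(** * Finite presentation type of Hom functors *)
Section FP.
Variables (R : nzRingType) (hR : artin_category R).
Implicit Types X Y Z W K L E P Q B C I F U V N D S : fgmod R.
Variables (D G : subcat R).
Hypotheses (GD : forall E, G E -> D E) (G0 : G (mod0 R))
  (Gsum : forall E E', G E -> G E' -> G (dsum E E')).

(** Hom(E, -) -> Hom(Z, -) is onto on D. *)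
Definition extends Z E (f : {linear Z -> E}) : Prop :=
  forall Y, D Y -> forall g : {linear Z -> Y},
    exists h : {linear E -> Y}, forall x, h (f x) = g x.

(** The functor Hom(Z, -) on D has the beginning of a projective resolution with
    n + 1 terms Hom(E, -), E in G. The kernel of Hom(E, -) -> Hom(Z, -) is
    Hom(C, -) for the cokernel C of Z -> E, so modules suffice to express this. *)
Fixpoint FP n Z : Prop :=
  if n is m.+1 then
    exists E C (f : {linear Z -> E}) (q : {linear E -> C}),
      [/\ G E, extends f, exact_at f q, surj q & FP m C]
  else exists E (f : {linear Z -> E}), G E /\ extends f.

Lemma FP_intro n Z E C (f : {linear Z -> E}) (q : {linear E -> C}) :
  G E -> extends f -> exact_at f q -> surj q ->
  (forall m, (m < n)%N -> FP m C) -> FP n Z.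
Proof.
case: n => [|n] GE ef e s h; first by exists E, f.
by exists E, C, f, q; split=> //; exact: h.
Qed.

Lemma FP_zero n Z : zero_mod Z -> FP n Z.
Proof.
elim: n Z => [|n IH] Z Z0.
  exists (mod0 R), (lzero _ _); split=> // Y _ g; exists (lzero _ _) => x.
  by rewrite [x]Z0 !linear0.
exists (mod0 R), (mod0 R), (lzero _ _), (lid _); split=> //.
- by move=> Y _ g; exists (lzero _ _) => x; rewrite [x]Z0 !linear0.
- by move=> y; split=> [_|_]; [exists 0; rewrite [y]zero_mod0|exact: zero_mod0].
- by move=> y; exists y.
- by apply: IH; exact: zero_mod0.
Qed.

Lemma FP_G n E : G E -> FP n E.
Proof.
move=> GE; apply: (FP_intro (f := lid E) (q := lzero E (mod0 R)) GE).
- by move=> Y _ g; exists g.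
- by move=> y; split=> // _; exists y.
- by move=> y; exists 0; apply/esym; exact: zero_mod0.
- by move=> m _; exact: FP_zero (@zero_mod0 R).
Qed.

(** Such a sequence gives a short exact sequence of functors
    0 -> Hom(Z', -) -> Hom(Z, -) -> Hom(Z'', -) -> 0 on D. *)
Definition D_exact Z'' Z Z' (a : {linear Z'' -> Z}) (b : {linear Z -> Z'}) : Prop :=
  [/\ surj b, exact_at a b & extends a].

(** The horseshoe lemma for the functors Hom(Z', -) and Hom(Z'', -): the
    approximation Z'' -> E2 extends to c on Z, and (f1 b, c) approximates Z. *)
Lemma FP_extension n Z'' Z Z' (a : {linear Z'' -> Z}) (b : {linear Z -> Z'}) :
  D_exact a b -> FP n Z' -> FP n Z'' -> FP n Z.
Proof.
have base Z2 Z0 Z1 (a0 : {linear Z2 -> Z0}) (b0 : {linear Z0 -> Z1})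
    E1 E2 (f1 : {linear Z1 -> E1}) (f2 : {linear Z2 -> E2}) (c : {linear Z0 -> E2}) :
    D_exact a0 b0 -> extends f1 -> extends f2 -> (forall x, c (a0 x) = f2 x) ->
    extends (lpair (lcomp f1 b0) c).
  move=> [bs ba _] e1 e2 ce Y DY g.
  have [g2 g2E] := e2 Y DY (lcomp g a0).
  have [|r rE] := factor_ses (g := lsub g (lcomp g2 c)) ba bs.
    by move=> x; rewrite /= ce g2E /= subrr.
  have [g1 g1E] := e1 Y DY r.
  exists (ladd (lcomp g1 (lfst E1 E2)) (lcomp g2 (lsnd E1 E2))) => x /=.
  by rewrite g1E rE /= subrK.
elim: n Z'' Z Z' a b => [|n IH] Z'' Z Z' a b hab.
  move=> [E1 [f1 [G1 e1]]] [E2 [f2 [G2 e2]]]; have [_ _ ae] := hab.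
  have [c cE] := ae _ (GD G2) f2.
  exists (dsum E1 E2), (lpair (lcomp f1 b) c); split; first exact: Gsum.
  exact: base hab e1 e2 cE.
move=> [E1 [C1 [f1 [q1 [G1 e1 x1 s1 h1]]]]] [E2 [C2 [f2 [q2 [G2 e2 x2 s2 h2]]]]].
have [bs ba ae] := hab; have [c cE] := ae _ (GD G2) f2.
pose f := lpair (lcomp f1 b) c.
have [C [q [qs qe]]] := coker_ex f.
exists (dsum E1 E2), C, f, q; split=> //; [exact: Gsum|exact: base hab e1 e2 cE|].
have fa x : f (a x) = linr E1 E2 (f2 x).
  by rewrite /f /= cE (_ : b (a x) = 0) ?linear0 //; apply/ba; exists x.
have [|u uE] := factor_ses (g := lcomp q (linr E1 E2)) x2 s2.
  by move=> x; rewrite -[LHS]/(q (linr E1 E2 (f2 x))) -fa; apply/qe; exists (a x).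
have [|v vE] := factor_ses (g := lcomp q1 (lfst E1 E2)) qe qs.
  by move=> x; apply/x1; exists (b x).
apply: (IH C2 C C1 u v) h1 h2; split.
- by move=> y; have [z zE] := s1 y; exists (q (linl E1 E2 z)); rewrite vE.
- move=> y; split=> [vy|[x <-]]; last first.
    by have [z <-] := s2 x; rewrite uE vE /= linear0.
  have [[z1 z2] zE] := qs y; have [|x xE] := (x1 z1).1.
    by rewrite -[LHS]/(lcomp q1 (lfst E1 E2) (z1, z2)) -vE zE.
  have [t tE] := bs x; exists (q2 (z2 - c t)); rewrite uE -zE /=.
  apply/eqP; rewrite -subr_eq0 -linearB; apply/eqP/qe; exists (- t).
  rewrite /f /=; apply: injective_projections => /=.
    by rewrite linearN linearN tE xE sub0r.
  by rewrite linearN addrAC subrr sub0r.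
- move=> Y DY g.
  pose k2 := lcomp g q2.
  have k20 x : k2 (f2 x) = 0.
    by rewrite /k2 /= (_ : q2 _ = 0) ?linear0 //; apply/x2; exists x.
  have [|r rE] := factor_ses (g := lcomp k2 c) ba bs.
    by move=> x; rewrite /= -[g (q2 _)]/(k2 (c (a x))) cE k20.
  have [k1 k1E] := e1 Y DY r.
  pose k : {linear dsum E1 E2 -> Y} :=
    lsub (lcomp k2 (lsnd E1 E2)) (lcomp k1 (lfst E1 E2)).
  have [|h hE] := factor_ses (g := k) qe qs.
    by move=> x; rewrite /k /= k1E rE /= subrr.
  exists h => y; have [z <-] := s2 y; rewrite uE hE /k /=.
  by rewrite linear0 subr0.
Qed.

Lemma FP_sub0 Z'' Z (a : {linear Z'' -> Z}) : extends a -> FP 0 Z -> FP 0 Z''.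
Proof.
move=> ae [E [f [GE fe]]]; exists E, (lcomp f a); split=> // Y DY g.
have [h hE] := ae Y DY g; have [k kE] := fe Y DY h.
by exists k => x; rewrite /= kE hE.
Qed.

(** An approximation of Z restricts to one of Z'', whose cokernel is an extension
    of those of Z -> E and Z'' -> Z. *)
Lemma FP_sub n Z'' Z Z' (a : {linear Z'' -> Z}) (b : {linear Z -> Z'}) :
  D_exact a b -> FP n.+1 Z -> FP n Z' -> FP n.+1 Z''.
Proof.
move=> [bs ba ae] [E [C [f [q [GE fe xe s hC]]]]] hZ'.
have [L [p [ps pe]]] := coker_ex (lcomp f a).
exists E, L, (lcomp f a), p; split=> //.
  move=> Y DY g; have [h hE] := ae Y DY g; have [k kE] := fe Y DY h.
  by exists k => x; rewrite /= kE hE.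
have [|u uE] := factor_ses (g := lcomp p f) ba bs.
  by move=> x; apply/pe; exists x.
have [|v vE] := factor_ses (g := q) pe ps.
  by move=> x; apply/xe; exists (a x).
apply: (FP_extension (a := u) (b := v)) hC hZ'; split.
- by move=> y; have [z <-] := s y; exists (p z); rewrite vE.
- move=> y; split=> [vy|[x <-]].
    have [e eE] := ps y; have [|z zE] := (xe e).1; first by rewrite -vE eE.
    by exists (b z); rewrite uE /= zE.
  by have [z <-] := bs x; rewrite uE /= vE; apply/xe; exists z.
- move=> Y DY g; have [h hE] := fe Y DY (lcomp g b).
  have [|k kE] := factor_ses (g := h) pe ps.
    move=> x; rewrite /= hE /= (_ : b _ = 0) ?linear0 //; by apply/ba; exists x.
  by exists k => x; have [z <-] := bs x; rewrite uE /= kE hE.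
Qed.

(** Extending Z'' -> E to c : Z -> E makes Z' + E an extension, in the sense of
    [D_exact], of Z and the cokernel of Z'' -> E; then split off E. *)
Lemma FP_quot n Z'' Z Z' (a : {linear Z'' -> Z}) (b : {linear Z -> Z'}) :
  D_exact a b -> FP n Z -> FP n.+1 Z'' -> FP n Z'.
Proof.
move=> [bs ba ae] hZ [E [C [f [q [GE fe xe s hC]]]]].
have [c cE] := ae _ (GD GE) f.
have [|t tE] := factor_ses (g := lcomp q c) ba bs.
  by move=> x; rewrite /= cE; apply/xe; exists x.
pose u : {linear Z -> dsum Z' E} := lpair b c.
pose v : {linear dsum Z' E -> C} := lsub (lcomp q (lsnd Z' E)) (lcomp t (lfst Z' E)).
have hQ : FP n (dsum Z' E).
  apply: (FP_extension (a := u) (b := v)) hC hZ; split.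
  - by move=> y; have [e eE] := s y; exists (0, e); rewrite /v /= linear0 subr0.
  - move=> [z e]; split=> [|[x]]; rewrite /u /v /=; last first.
      by case=> <- <-; rewrite tE /= subrr.
    have [y yE] := bs z; rewrite -{1}yE tE /= -linearB => /xe[w wE].
    exists (y + a w); rewrite !linearD cE wE [c y + _]addrC subrK yE.
    by rewrite (_ : b (a w) = 0) ?addr0 //; apply/ba; exists w.
  - move=> Y DY g; have [h hE] := fe Y DY (lcomp g a).
    have [|r rE] := factor_ses (g := lsub g (lcomp h c)) ba bs.
      by move=> x; rewrite /= cE hE /= subrr.
    exists (ladd (lcomp r (lfst Z' E)) (lcomp h (lsnd Z' E))) => x.
    by rewrite /u /= rE /= subrK.
have sp : D_exact (linl Z' E) (lsnd Z' E).
  split.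
  - by move=> y; exists (0, y).
  - by move=> [x y]; split=> /= [->|[z [_ <-]]//]; exists x.
  - by move=> Y _ g; exists (lcomp g (lfst Z' E)).
case: n hQ {hZ hC} => [|n] hQ; last by apply: FP_sub sp hQ (FP_G _ GE).
by case: sp => _ _ h; exact: FP_sub0 h hQ.
Qed.

Lemma FP_dsum n X X' : FP n X -> FP n X' -> FP n (dsum X X').
Proof.
move=> h h'; apply: (FP_extension (a := linl X X') (b := lsnd X X')) h' h; split.
- by move=> y; exists (0, y).
- by move=> [x y]; split=> /= [->|[z [_ <-]]//]; exists x.
- by move=> Y _ g; exists (lcomp g (lfst X X')).
Qed.

(** The complement K of Y in Z is again a retract of Z, so that by induction the
    sequence Y -> Z -> K can be used. *)
Lemma FP_retract n Y Z : (forall m, FP m Z) -> retract Y Z -> FP n Y.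
Proof.
move=> hZ; elim: n Y => [|n IH] Y [i [p e]].
  by apply: (FP_sub0 (a := i)) => // V _ g; exists (lcomp g p) => x; rewrite /= e.
have [K [b [bs be]]] := coker_ex i.
have [|s sE] := factor_ses (g := lsub (lid Z) (lcomp i p)) be bs.
  by move=> x; rewrite /= e subrr.
apply: (FP_sub (a := i) (b := b)) (hZ _) _.
  by split=> // V _ g; exists (lcomp g p) => x; rewrite /= e.
apply: IH; exists s, b => y; have [z <-] := bs y.
rewrite sE /= linearB (_ : b (i _) = 0) ?subr0 //; by apply/be; exists (p z).
Qed.

(** Under the hypothesis Hom(K, -) and Hom(P, -) agree on D. *)
Lemma FP_epi n P K (p : {linear P -> K}) : surj p ->
  (forall Y, D Y -> forall (g : {linear P -> Y}) x, p x = 0 -> g x = 0) ->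
  FP n P -> FP n K.
Proof.
move=> ps kill.
have base E (f : {linear P -> E}) : G E -> extends f ->
    exists f' : {linear K -> E}, extends f' /\ forall x, f' (p x) = f x.
  move=> GE fe; have [f' f'E] := factor_surj ps (kill _ (GD GE) f).
  exists f'; split=> // Y DY g; have [h hE] := fe Y DY (lcomp g p).
  by exists h => y; have [x <-] := ps y; rewrite f'E hE.
case: n => [[E [f [GE fe]]]|n [E [C [f [q [GE fe e s h]]]]]];
  have [f' [fe' f'E]] := base _ f GE fe; first by exists E, f'.
exists E, C, f', q; split=> // y; split=> [/e[x <-]|[k <-]].
  by exists (p x).
by have [x <-] := ps k; rewrite f'E; apply/e; exists x.
Qed.

End FP.

(** * Every Ext^d-projective occurs in the coresolution *)
Section Generator.
Variables (R : nzRingType) (hR : artin_category R) (d : nat).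
Implicit Types X Y Z W K L E P Q B C I F U V N D S : fgmod R.
Variables (M T : subcat R).
Hypotheses (hd : (1 <= d)%N) (hM : d_cluster_tilting d M) (hT : torsion_class T)
  (hTff : functorially_finite T) (hTM : induces_d_torsion_class d M T).
Local Notation U := (cap T M).
Variables (T0 : fgmod R) (hT0 : Ext_projective_generator 1 T T0)
  (us : seq (fgmod R)) (hus : min_coresolution M T0 us)
  (usU : forall i, (i < size us)%N -> U (nth (mod0 R) us i)).

(** The objects of U all of whose indecomposable summands occur in the
    coresolution; a substitute for the additive closure that makes closure under
    direct sums a consequence of [retract_dsum]. *)
Definition occurring E : Prop :=
  U E /\ forall Y, indecomposable Y -> retract Y E -> retract Y (dsums us).

Lemma occurring_U E : occurring E -> U E. Proof. by case. Qed.

Lemma U_dsum E E' : U E -> U E' -> U (dsum E E').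
Proof.
move=> [TE ME] [TE' ME'].
have [[_ _ h _] _ _] := hT; have [[_ _ h' _] _ _ _] := hM.
by split; [exact: h|exact: h'].
Qed.

Lemma occurring_mod0 : occurring (mod0 R).
Proof.
split; last by move=> Y [nz _] /(retract_zero (@zero_mod0 R)).
by have [[_ h _ _] _ _] := hT; have [[_ h' _ _] _ _ _] := hM.
Qed.

Lemma occurring_dsum E E' : occurring E -> occurring E' -> occurring (dsum E E').
Proof.
move=> [UE h] [UE' h']; split; first exact: U_dsum.
by move=> Y hY /(retract_dsum hR hY)[]; [exact: h|exact: h'].
Qed.

Lemma occurring_nth i : (i < size us)%N -> occurring (nth (mod0 R) us i).
Proof.
move=> lt; split; first exact: usU.
by move=> Y _ h; apply: retract_trans h (nth_retract_dsums lt).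
Qed.

Local Notation FP := (FP U occurring).

Lemma FP_coresolution n C vs : min_coresolution M C vs ->
  (forall i, (i < size vs)%N -> occurring (nth (mod0 R) vs i)) -> FP n C.
Proof.
elim: vs n C => [|V vs IH] n C /=.
  by move=> C0 _; exact: (FP_zero U occurring_mod0 n C0).
move=> [f [C' [q [ap _ [_ e s] co]]]] hV.
apply: (FP_intro (f := f) (q := q) _ _ e s); first exact: (hV 0%N).
  by move=> Y [_ MY] g; exact: ap.2.
by move=> m _; apply: IH => // i lt; exact: (hV i.+1).
Qed.

Lemma FP_T0 n : FP n T0. Proof. exact: FP_coresolution hus occurring_nth. Qed.

Lemma FP_add n X : add T0 X -> FP n X.
Proof.
move=> [m /(dsummandE hR) h].
apply: (FP_retract occurring_U occurring_dsum _ _ h) => {}n.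
elim: m {h} => [|m IH] /=; first exact: (FP_zero U occurring_mod0 n (@zero_mod0 R)).
exact: (FP_dsum occurring_U occurring_dsum (FP_T0 n) IH).
Qed.

Lemma FP_Ext_projective n X : T X -> (forall Y, T Y -> Ext1 X Y) -> FP n X.
Proof.
move=> TX h; apply: FP_add; apply: hT0.2; split=> // Y TY.
by apply/(Ext_zeroE hR 0); exact: h.
Qed.

(** The target of the minimal left T-approximation f : P -> TP is Ext^1-projective:
    f lifts along any extension of TP, and minimality splits it. So is its
    cokernel C, since maps on the image of f to torsion modules extend to TP.
    Both are therefore summands of sums of copies of T0. *)
Lemma FP_projective n P : projective P -> FP n P.
Proof.
move=> hP.
have [TP [f [[TTP ap] mi]]] : exists V (f : {linear P -> V}),
    left_approx T f /\ left_minimal f.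
  by apply: (min_left_approx hR) => //; [move=> ? ? ?; exact: T_quot|case: (hTff P)].
have [C [q [qs qe]]] := coker_ex f.
have TC : T C by exact: T_quot qs TTP.
have E1 Y : T Y -> Ext1 TP Y.
  move=> TY; apply: lift_Ext1 => E i p s; have [_ _ ps] := s.
  have [l lE] := hP _ _ p f ps.
  have [h hE] := ap _ l (T_extension hT s TY TTP).
  have [|r [r1 r2]] := @bij_linear_inv _ _ _ (lcomp p h).
    by apply: mi => x /=; rewrite hE lE.
  by exists (lcomp h r) => x; exact: r2.
have E2 Y : T Y -> Ext1 C Y.
  move=> TY; have [I [p [i [ps ii ip]]]] := image_ex hR f.
  have s : short_exact i q.
    split=> // y; split=> [/qe[x <-]|[x <-]]; first by exists (p x).
    by have [z <-] := ps x; rewrite ip; apply/qe; exists z.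
  apply: (Ext_contra_quot0 hR s) (E1 _ TY) => g.
  have [h hE] := ap _ (lcomp g p) TY.
  by exists h => x; have [z <-] := ps x; rewrite ip hE.
have ef : extends U f by move=> Y [TY _] g; exact: ap.
have hTP m : FP m TP by exact: FP_Ext_projective.
case: n => [|n]; first exact: FP_sub0 ef (hTP _).
apply: (FP_sub occurring_U occurring_dsum (a := f) (b := q)) (hTP _) _ => //.
exact: FP_Ext_projective.
Qed.

(** The syzygy K of X can be replaced by its projective cover P' -> K, with kernel
    L, because every c : P' -> Y with Y in U kills L. Indeed let W = c(L); modulo W
    the map c factors through K, so it extends to P by Ext^1(X, Y/W) = 0. Subtracting
    a lift of this extension to Y leaves c2 : P' -> W which agrees with c on L, so
    that L and the kernel D of c2 span P'. Then D maps onto K and equals P', whence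
    W = 0. *)
Lemma FP_Ext1 m X : (forall Z, T Z -> Ext1 X Z) -> FP m X.
Proof.
move=> hX; have [K [P [i [p [hP s]]]]] := presentation hR X.
have [P' [p' [hP' ps' cov]]] := projective_cover hR K.
have [L [l sl]] := ses_kernel hR ps'.
have kill Y : U Y -> forall (c : {linear P' -> Y}) x, p' x = 0 -> c x = 0.
  move=> [TY _] c x px; have [_ le _] := sl.
  have [W [e [w [es wi we]]]] := image_ex hR (lcomp c l).
  have [Q [q sq]] := ses_coker wi; have [_ qe qs] := sq.
  have [|c1 c1E] := @factor_surj _ _ _ _ p' (lcomp q c) ps'.
    move=> y /le[z <-]; rewrite -[LHS]/(q (lcomp c l z)) -we.
    exact: ses_comp0 sq.
  have [b bE] := hX _ (T_quot hT qs TY) _ _ _ _ s c1.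
  have [b' b'E] := hP _ _ q b qs.
  have [|c2 c2E] := lift_ses (g := lsub c (lcomp b' (lcomp i p'))) qe wi.
    by move=> y; rewrite /= linearB b'E bE c1E /= subrr.
  have c2l z : w (c2 (l z)) = c (l z).
    by rewrite c2E /= (ses_comp0 _ sl) !linear0 ?subr0 ?addr0.
  have [D [j [ji je]]] := kernel_ex hR c2.
  have js : surj j.
    apply: cov => k; have [y yE] := ps' k.
    have [z zE] := es (c2 y).
    have [|t tE] := (je (y - l z)).1.
      rewrite linearB -zE; apply/eqP; rewrite subr_eq0; apply/eqP; apply: wi.
      by rewrite c2l we.
    by exists t; rewrite /= tE linearB (ses_comp0 _ sl) subr0.
  have [z zE] := (le x).1 px; rewrite -zE -c2l.
  by have [t <-] := js (l z); rewrite (_ : c2 _ = 0) ?linear0 //; apply/je; exists t.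
apply: (FP_quot occurring_U occurring_mod0 occurring_dsum
  (a := i) (b := p)) (FP_projective m hP) _.
  have [_ ie ps] := s; split=> // Y [TY _] g; exact: (hX _ TY _ _ _ _ s).
exact: (FP_epi occurring_U ps' kill (FP_projective _ hP')).
Qed.

(** Descend along the syzygies of X: the functor of a syzygy is the quotient of that
    of the projective module by that of X. *)
Lemma FP_ExtS n m X : (forall Y, U Y -> forall j, (j < n)%N -> ExtS j X Y) ->
  (forall Z, T Z -> ExtS n X Z) -> FP m X.
Proof.
elim: n m X => [|n IH] m X hU hTX; first exact: FP_Ext1.
have [K [P [i [p [hP s]]]]] := presentation hR X.
apply: (FP_quot occurring_U occurring_mod0 occurring_dsum
  (a := i) (b := p)) (FP_projective m hP) _.
  have [_ ie ps] := s; split=> // Y UY g; exact: (hU _ UY 0%N isT _ _ _ _ s).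
apply: IH => [Y UY j lt|Z TZ]; first exact: (hU _ UY j.+1 lt _ _ _ _ hP s).
exact: (hTX _ TZ _ _ _ _ hP s).
Qed.

(** Coresolve the torsion module Z by left M-approximations with targets in U. In
    the k-th cokernel Ext^j(-, M) vanishes for 0 < j <= k, so after d - 1 steps the
    cokernel lies in M, and hence in U. *)
Lemma Ext_top_T X : M X -> (forall Y, U Y -> ExtS d.-1 X Y) ->
  forall Z, T Z -> ExtS d.-1 X Z.
Proof.
move=> MX hX.
have hle Y n : U Y -> (n < d)%N -> ExtS n X Y.
  move=> UY lt; have [->|ne] := eqVneq n d.-1; first exact: hX.
  by apply: (M_ext hR hM) => //; [case: UY|lia].
suff key e k Z : (e + k = d.-1)%N -> T Z ->
    (forall N, M N -> forall n, (n < k)%N -> ExtS n Z N) -> ExtS e X Z.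
  by move=> Z TZ; apply: (key d.-1 0%N); rewrite ?addn0.
elim: e k Z => [|e IH] k Z ek TZ hZ.
  apply: hle => //; split=> //; apply: (M_left hR hM) => N MN n lt.
  by apply: hZ => //; lia.
have [E [C [f [q [UE ap s]]]]] := left_U_approx hR hd hM hT hTff hTM TZ.
have [TE ME] := UE; have [_ _ qs] := s.
apply: (Ext_cov_sub s); last by apply: hle => //; lia.
apply: (IH k.+1); [lia|exact: (T_quot hT qs TE)|].
move=> N MN [|n] lt.
  apply: (Ext_contra_quot0 hR s); last by apply: (@M_ext _ hR d _ hM _ _ 0) => //; lia.
  by move=> g; exact: ap.2.
apply: (Ext_contra_quot hR s); first exact: hZ.
by apply: (M_ext hR hM) => //; lia.
Qed.

(** As X lies in U, the identity of X factors through the approximation X -> E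
    provided by the previous results. *)
Lemma Ext_projective_retract X : indecomposable X -> Ext_projective d U X ->
  retract X (dsums us).
Proof.
move=> hX [UX h]; have [TX MX] := UX.
have h' Y : U Y -> ExtS d.-1 X Y.
  by move=> UY; apply/(Ext_zeroE hR); rewrite prednK //; exact: h.
have [E [f [GE fe]]] : FP 0 X.
  apply: (@FP_ExtS d.-1) => [Y UY j lt|]; last exact: Ext_top_T.
  by apply: (M_ext hR hM) => //; [case: UY|lia].
by have [r rE] := fe X UX (lid X); apply: GE.2 => //; exists f, r.
Qed.

End Generator.

(** * Comparison of the two basic modules *)
Section Compare.
Variables (R : nzRingType) (hR : artin_category R) (d : nat).
Implicit Types X Y Z W K L E P Q B C I F U V N D S : fgmod R.
Variables (M T : subcat R).
Hypotheses (hd : (1 <= d)%N) (hM : d_cluster_tilting d M) (hT : torsion_class T)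
  (hTff : functorially_finite T) (hTM : induces_d_torsion_class d M T).
Local Notation U := (cap T M).

Lemma Ext_projective_sub X Y : retract Y X -> Ext_projective d U X ->
  Ext_projective d U Y.
Proof.
move=> r [[TX MX] h]; have [i [p e]] := r; split.
  by split; [exact: (T_retract hT r)|exact: (M_retract hR hM r)].
move=> Z UZ; rewrite -(prednK hd); apply/(Ext_zeroE hR); apply: (ExtS_retract hR e).
by apply/(Ext_zeroE hR); rewrite prednK //; exact: h.
Qed.

Lemma Ext_projective_dsums (us : seq (fgmod R)) :
  (forall i, (i < size us)%N -> Ext_projective d U (nth (mod0 R) us i)) ->
  Ext_projective d U (dsums us).
Proof.
elim: us => [|X us IH] h /=.
  split; first by have [[_ ? _ _] _ _] := hT; have [[_ ? _ _] _ _ _] := hM.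
  move=> Z UZ; rewrite -(prednK hd); apply/(Ext_zeroE hR).
  by apply: projective_ExtS => //; exact: mod0_projective.
have [UX eX] := h 0%N isT.
have [|Us es] := IH; first by move=> i lt; exact: (h i.+1).
split; first exact: (U_dsum hM hT).
move=> Z UZ; rewrite -(prednK hd); apply/(Ext_zeroE hR); apply: (ExtS_dsum hR);
  by apply/(Ext_zeroE hR); rewrite prednK //; first [exact: eX|exact: es].
Qed.

(** The multiplicity-free lists of summands of B and Gen are compared through the
    sum of the terms of the coresolution, using locality to pass from summands of
    finite sums to summands of the terms. *)
Lemma basic_coresolution_iso T0 B Gen us :
  Ext_projective_generator 1 T T0 -> min_coresolution M T0 us ->
  basic_part (dsums us) B -> basic Gen -> Ext_projective_generator d U Gen ->
  iso B Gen.
Proof.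
move=> hT0 hus [s [hs sus iB]] [t [ht iG]] [hG genG].
have [[TT0 eT0] _] := hT0.
have usP := coresolution_Ext_projective hR hd hM hT hTff hTM hus TT0.
have {}usP i : (i < size us)%N -> Ext_projective d U (nth (mod0 R) us i).
  apply: usP => m K _ hK; apply/(Ext_zeroE hR 0); apply: eT0.
  exact: chain_T hK.
have Wp := Ext_projective_dsums usP.
apply: iso_trans iB _; apply: iso_trans _ (iso_sym iG).
have [sind _] := hs; have [tind _] := ht.
apply: basic_unique => // [i li|j lj].
- have hi := sind i li.
  have [|m /(dsummandE hR) r] := genG (nth (mod0 R) s i).
    apply: Ext_projective_sub Wp; apply/(dsummandE hR)/sus => //.
    by exists i => //; exact: iso_refl.
  have rG : retract (nth (mod0 R) s i) Gen.
    have [k] := retract_dsums hR hi r; rewrite size_nseq => lk.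
    by rewrite nth_nseq lk.
  have [j lj rj] := retract_dsums hR hi (retract_trans rG (iso_retract iG)).
  by exists j => //; apply: (retract_iso hR) rj => //; exact: tind.
- have hj := tind j lj.
  have ej : Ext_projective d U (nth (mod0 R) t j).
    apply: Ext_projective_sub hG; apply: retract_trans (nth_retract_dsums lj) _.
    exact/iso_retract/iso_sym.
  have usU i : (i < size us)%N -> U (nth (mod0 R) us i) by move=> /usP[].
  have r := Ext_projective_retract hR hd hM hT hTff hTM hT0 hus usU hj ej.
  by apply/sus => //; apply/(dsummandE hR).
Qed.

End Compare.

(** * Modules over a finite-dimensional algebra *)
Section FinDim.
Variable k : fieldType.

(** A generating family of least cardinality is a basis: a relation with a nonzero
    coefficient at i0 would allow dropping the generator at i0. *)
Lemma findim_ex (V : lmodType k) :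
  (exists (I : finType) (g : I -> V),
     forall x, exists c : I -> k, x = \sum_i c i *: g i) ->
  exists n, exists f : {linear 'rV[k]_n -> V}, bijective f.
Proof.
move=> [I [b bP]].
pose S n := exists g : 'I_n -> V, forall x, exists c : 'I_n -> k, x = \sum_i c i *: g i.
have [|n [[g gP] min]] := @ex_min S.
  exists #|I|, (fun i => b (enum_val i)) => x; have [c ->] := bP x.
  exists (fun i => c (enum_val i)).
  rewrite (reindex (@enum_val I predT)) //=.
  exact/onW_bij/enum_val_bij.
exists n; have [|f fE] := @linear_ex k 'rV[k]_n V (fun v => \sum_i v 0 i *: g i).
  move=> a x y; rewrite scaler_sumr -big_split; apply: eq_bigr => i _.
  by rewrite !mxE scalerDl scalerA.
exists f; apply: inj_surj_bij; last first.
  move=> x; have [c ->] := gP x; exists (\row_i c i); rewrite fE.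
  by apply: eq_bigr => i _; rewrite mxE.
apply: inj_ker0 => v; rewrite fE => v0; apply/rowP => i0; rewrite mxE.
apply/eqP/negPn/negP => nz.
case: n g gP min f fE v v0 i0 nz => [|n] g gP min f fE v v0 i0 nz.
  by case: i0 {nz}.
suff /min : S n by rewrite ltnn.
exists (fun j => g (lift i0 j)) => x; have [c ->] := gP x.
exists (fun j => c (lift i0 j) - c i0 * (v 0 i0)^-1 * v 0 (lift i0 j)).
have gi0 : g i0 = - \sum_(j < n) ((v 0 i0)^-1 * v 0 (lift i0 j)) *: g (lift i0 j).
  have := congr1 (fun y => (v 0 i0)^-1 *: y) v0.
  rewrite /= scaler0 (bigD1_ord i0) //= scalerDr scalerA mulVf // scale1r => /eqP.
  rewrite addr_eq0 => /eqP ->; rewrite scaler_sumr; congr (- _).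
  by apply: eq_bigr => j _; rewrite scalerA.
rewrite (bigD1_ord i0) //= gi0 scalerN scaler_sumr addrC -sumrB.
by apply: eq_bigr => j _; rewrite scalerBl scalerA mulrA.
Qed.

Variable A : falgType k.

(** A right A-module as a vector space over k, scalars acting through A. *)
Definition restr (X : fgmod A^c) : Type := X.

Section Restr.
Variable X : fgmod A^c.
HB.instance Definition _ := GRing.Zmodule.on (restr X).

Definition rscale (c : k) (x : restr X) : restr X := (c%:A : A^c) *: (x : X).

Fact rscaleA a b (v : restr X) : rscale a (rscale b v) = rscale (a * b) v.
Proof.
rewrite /rscale scalerA; congr (_ *: _); change (b%:A * a%:A = (a * b)%:A :> A).
by rewrite mulr_algl scalerA mulrC.
Qed.
Fact rscale1 : left_id 1 rscale.
Proof. by move=> x; rewrite /rscale scale1r; exact: scale1r. Qed.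
Fact rscaleDr : right_distributive rscale +%R.
Proof. by move=> a x y; exact: scalerDr. Qed.
Fact rscaleDl v : {morph rscale^~ v : a b / a + b}.
Proof. by move=> a b; rewrite /rscale scalerDl; exact: (@scalerDl A^c X). Qed.
HB.instance Definition _ := GRing.Zmodule_isLmodule.Build k (restr X)
  rscaleA rscale1 rscaleDr rscaleDl.

Lemma restr_scale c (x : restr X) : c *: x = (c%:A : A^c) *: (x : X).
Proof. by []. Qed.

(** The products of a k-basis of A with module generators span. *)
Lemma restr_findim : exists n, exists f : {linear restr X -> 'rV[k]_n}, bijective f.
Proof.
have [n [g gP]] := fgmod_gen X.
have [|m [f /bij_linear_inv[h [fh hf]]]] := @findim_ex (restr X); last first.
  by exists m, h; exists f.
exists ('I_n * 'I_(\dim {:A}))%type.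
exists (fun ij : 'I_n * 'I_(\dim {:A}) => ((vbasis {:A})`_ij.2 : A^c) *: g ij.1) => x.
have [c ->] := gP x; exists (fun ij => coord (vbasis {:A}) ij.2 (c ij.1)).
rewrite -(pair_bigA _ (fun i j => coord (vbasis {:A}) j (c i) *:
   (((vbasis {:A})`_j : A^c) *: g i : restr X))) /=.
apply: eq_bigr => i _.
rewrite {1}(coord_vbasis (memvf (c i : A))) [LHS](scaler_suml (R := A^c)).
apply: eq_bigr => j _; rewrite restr_scale [RHS]scalerA.
refine (congr1 (fun t : A^c => t *: g i) _).
by change (coord (vbasis {:A}) j (c i) *: (vbasis {:A})`_j =
  (vbasis {:A})`_j * (coord (vbasis {:A}) j (c i))%:A); rewrite mulr_algr.
Qed.

Let rdim := sval (cid restr_findim).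
Fact restr_axiom : Vector.axiom rdim (restr X).
Proof.
rewrite /rdim; case: cid => n /= /cid[f bf]; exists f => //.
exact: linearP.
Qed.
HB.instance Definition _ := Lmodule_hasFinDim.Build k (restr X) restr_axiom.
End Restr.

Lemma restr_linear (X Y : fgmod A^c) (f : {linear X -> Y}) :
  exists g : 'Hom(restr X, restr Y), forall x, g x = f x.
Proof.
have [|h hE] := @linear_ex k (restr X) (restr Y) f.
  by move=> a x y; exact: linearP.
by exists (linfun h) => x; rewrite lfunE /= hE.
Qed.

Lemma lfun_inj_dim (V W : vectType k) (g : 'Hom(V, W)) : injective g ->
  (\dim {:V} <= \dim {:W})%N /\
  ((\dim {:W} <= \dim {:V})%N -> forall y, exists x, g x = y).
Proof.
move=> gi; have k0 : lker g == 0%VS by apply/lker0P.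
have e : \dim (limg g) = \dim {:V} by apply: limg_dim_eq; rewrite (eqP k0) capv0.
split=> [|le y]; first by rewrite -e dimvS // subvf.
have /eqP ef : limg g == fullv by rewrite eqEdim subvf e.
by have := memvf y; rewrite -ef => /memv_imgP[x _ ->]; exists x.
Qed.

Lemma lfun_surj_dim (V W : vectType k) (g : 'Hom(V, W)) :
  (forall y, exists x, g x = y) ->
  (\dim {:W} <= \dim {:V})%N /\ ((\dim {:V} <= \dim {:W})%N -> injective g).
Proof.
move=> gs; have ef : limg g = fullv.
  apply/eqP; rewrite eqEsubv subvf; apply/subvP => y _.
  by have [x <-] := gs y; rewrite memv_img ?memvf.
have e := limg_ker_dim g {:V}; rewrite ef in e.
split=> [|le]; first by rewrite -e leq_addl.
apply/lker0P; rewrite -dimv_eq0 -(capfv (lker g)) -leqn0.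
by rewrite -(leq_add2r (\dim {:W})) e.
Qed.

(** Any additive and k-stable predicate is a subspace: take one of least codimension
    on which it holds. *)
Lemma subspace_ex (V : vectType k) (S : V -> Prop) : closed_under S ->
  exists W : {vspace V}, forall x, S x <-> x \in W.
Proof.
move=> [S0 SP].
pose Q n := exists W : {vspace V}, (forall x, x \in W -> S x) /\
  n = (\dim {:V} - \dim W)%N.
have [|n [[W [WS nE]] min]] := @ex_min Q.
  exists (\dim {:V} - 0)%N, 0%VS; rewrite dimv0; split=> // x.
  by rewrite memv0 => /eqP ->.
exists W => x; split=> [Sx|]; last exact: WS.
apply/negPn/negP => nx.
have : Q (\dim {:V} - \dim (W + <[x]>))%N.
  exists (W + <[x]>)%VS; split=> // y /memv_addP[u /WS Su [v /vlineP[a ->] ->]].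
  by rewrite addrC; exact: SP.
move=> /min; rewrite nE.
have : (\dim W < \dim (W + <[x]>))%N.
  rewrite ltn_neqAle dimvS ?addvSl // andbT; apply: contra nx => /eqP e.
  have /eqP -> : W == (W + <[x]>)%VS by rewrite eqEdim addvSl e leqnn.
  by apply: (subvP (addvSr _ _)); rewrite memv_line.
have : (\dim (W + <[x]>) <= \dim {:V})%N by rewrite dimvS ?subvf.
lia.
Qed.

Lemma restr_sub_fg (X : fgmod A^c) (S : X -> Prop) : closed_under S ->
  exists n (g : 'I_n -> X), (forall i, S (g i)) /\
    forall x, S x -> exists c : 'I_n -> A^c, x = \sum_(i < n) c i *: g i.
Proof.
move=> [S0 SP]; have [|W WP] := @subspace_ex (restr X) S.
  by split=> // a x y; exact: SP.
exists (\dim W), (fun i => (vbasis W)`_i); split.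
  by move=> i; apply/WP/vbasis_mem/mem_nth; rewrite size_tuple.
move=> x /WP xW; exists (fun i => (coord (vbasis W) i x)%:A).
exact: (coord_vbasis xW).
Qed.

(** The coinduced module Hom_k(A, V). A linear map from E to it is the same as a
    k-linear map E -> V, by evaluation at 1; as k-linear maps extend along
    injections, it is injective. *)
Definition coind (V : vectType k) : Type := 'Hom(A, V).

Section Coind.
Variable V : vectType k.
HB.instance Definition _ := GRing.Zmodule.on (coind V).

Lemma amullE (r a : A) : amull r a = r * a. Proof. by rewrite lfunE. Qed.

Definition cscale (r : A^c) (u : coind V) : coind V :=
  ((u : 'Hom(A, V)) \o amull (r : A))%VF.
Lemma cscaleE r (u : coind V) a :
  (cscale r u : 'Hom(A, V)) a = (u : 'Hom(A, V)) ((r : A) * a).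
Proof. by rewrite comp_lfunE amullE. Qed.

Fact cscaleA a b (v : coind V) : cscale a (cscale b v) = cscale (a * b) v.
Proof. by apply/lfunP => x; rewrite !cscaleE [in LHS]mulrA. Qed.
Fact cscale1 : left_id 1 cscale.
Proof. by move=> u; apply/lfunP => x; rewrite cscaleE mul1r. Qed.
Fact cscaleDr : right_distributive cscale +%R.
Proof.
by move=> a u v; apply/lfunP => x; rewrite cscaleE !add_lfunE !cscaleE.
Qed.
Fact cscaleDl v : {morph cscale^~ v : a b / a + b}.
Proof.
move=> a b; apply/lfunP => x; rewrite cscaleE add_lfunE !cscaleE -linearD.
by rewrite -mulrDl.
Qed.
HB.instance Definition _ := GRing.Zmodule_isLmodule.Build A^c (coind V)
  cscaleA cscale1 cscaleDr cscaleDl.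

Fact coind_gen : exists n (g : 'I_n -> coind V),
  forall x, exists c : 'I_n -> A^c, x = \sum_(i < n) c i *: g i.
Proof.
exists (\dim {:'Hom(A, V)}), (fun i => (vbasis {:'Hom(A, V)})`_i) => u.
exists (fun i => (coord (vbasis {:'Hom(A, V)}) i u)%:A).
rewrite {1}(coord_vbasis (memvf (u : 'Hom(A, V)))).
apply: eq_bigr => i _; apply/lfunP => a; rewrite [RHS]cscaleE.
by rewrite mulr_algl linearZ lfun_simp.
Qed.
Definition coind_mod : fgmod A^c := FGMod coind_gen.

(** The adjoint of a k-linear map u. *)
Lemma coev (E : fgmod A^c) (u : 'Hom(restr E, V)) :
  exists h : {linear E -> coind_mod},
    forall e (a : A), (h e : 'Hom(A, V)) a = u ((a : A^c) *: e).
Proof.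
have lin e : linear (fun a : A => u ((a : A^c) *: e : E)).
  move=> c a b; rewrite -linearP; congr (u _).
  rewrite restr_scale scalerA; refine (etrans _ (@scalerDl A^c E e _ _)).
  refine (congr1 (fun t : A^c => t *: e) _).
  by change (c *: a + b = a * c%:A + b); rewrite mulr_algr.
have /choice[f fE] e : exists f : 'Hom(A, V), forall a, f a = u ((a : A^c) *: e : E).
  by have [g gE] := linear_ex (lin e); exists (linfun g) => a; rewrite lfunE /= gE.
have [|h hE] := @linear_ex A^c E coind_mod f; last by exists h => e a; rewrite hE fE.
move=> r x y; apply/lfunP => a; rewrite !fE add_lfunE fE.
rewrite scalerDr [LHS]linearD; congr (_ + _).
by rewrite [RHS]cscaleE fE scalerA.
Qed.

Lemma coind_injective : injective_module coind_mod.
Proof.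
move=> K E i g ii; have [ki kiE] := restr_linear i.
have k0 : lker ki == 0%VS by apply/lker0P => x y; rewrite !kiE; exact: ii.
have [|g0 g0E] := @linear_ex k (restr K) V (fun x => (g x : 'Hom(A, V)) 1).
  move=> c x y; rewrite [g _]linearP add_lfunE [X in X + _]cscaleE.
  by rewrite mulr1 linearZ.
have [h hE] := coev (linfun g0 \o ki^-1)%VF.
exists h => x; apply/lfunP => a; rewrite hE comp_lfunE -linearZ -kiE.
rewrite (lker0_lfunK k0) lfunE /= g0E linearZ [LHS]cscaleE mulr1 //.
Qed.

End Coind.

Lemma coind_embed (X : fgmod A^c) :
  exists (I : fgmod A^c) (i : {linear X -> I}), injective i /\ injective_module I.
Proof.
have [h hE] := coev (\1%VF : 'End(restr X)).
exists (coind_mod (restr X)), h; split; last exact: coind_injective.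
move=> x y e; have := congr1 (fun u : 'Hom(A, restr X) => u 1) e.
by rewrite !hE !id_lfunE !scale1r.
Qed.

(** The dimension over k serves as the length. *)
Lemma findim_artin : inhabited (artin_category A^c).
Proof.
split; refine (@ArtinCategory A^c restr_sub_fg (fun X => \dim {:restr X})
  _ _ _ _ coind_embed).
- move=> X Y f fi; have [g gE] := restr_linear f.
  by have [|//] := @lfun_inj_dim _ _ g; move=> x y; rewrite !gE; exact: fi.
- move=> X Y f fi le y; have [g gE] := restr_linear f.
  have [|_ h] := @lfun_inj_dim _ _ g; first by move=> x z; rewrite !gE; exact: fi.
  by have [x xE] := h le y; exists x; rewrite -gE.
- move=> X Y f fs; have [g gE] := restr_linear f.
  by have [|//] := @lfun_surj_dim _ _ g; move=> y; have [x <-] := fs y; exists x.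
- move=> X Y f fs le x y e; have [g gE] := restr_linear f.
  have [|_ h] := @lfun_surj_dim _ _ g; last by apply: h; rewrite ?gE.
  by move=> z; have [t <-] := fs z; exists t.
Qed.
End FinDim.

Theorem corollary6p6 (k : fieldType) (A : falgType k) (d : nat)
    (hd : (1 <= d)%N)
    (M : subcat A^c) (hM : d_cluster_tilting d M)
    (T : subcat A^c) (hT : torsion_class T) (hTff : functorially_finite T)
    (hTM : induces_d_torsion_class d M T)
    (TP : fgmod A^c * fgmod A^c) (hTP : phi 1 T TP)
    (B : fgmod A^c) (hB : alpha d M TP B)
    (MP : fgmod A^c * fgmod A^c) (hMP : phi d (cap T M) MP) :
  iso B (beta MP).
Proof.
have [hR] := findim_artin A.
case: hTP => _ hT0 _ _; case: hMP => basG genG _ _.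
case: hB => us [_ hus bB].
exact: (basic_coresolution_iso hR hd hM hT hTff hTM hT0 hus bB basG genG).
Qed.
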